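(* Let $M\ge 1$, $L_1,\dots,L_M\in\mathbb{N}=\{1,2,\dots\}$, and $q_1,\dots,q_M\in\mathbb{R}[x]$ with $\deg q_j<2L_j$ and $q_j(0)=0$ for each $j$. Let $$P(x,y)=\prod_{j=1}^{M}\bigl(y+q_j(x)+i x^{2L_j}\bigr).$$ Let $1\le \mathfrak{p}<\infty$ and $Q\in\mathbb{C}\{x,y\}$. Then $Q\in\mathcal{I}^{\mathfrak{p}}_P$ if and only if for every $j=1,\dots,M$, $$O(2L_j,q_j,Q)\ \ge\ \sum_{i=1}^{M}O_{ij}-\left\lceil\frac{2L_j+1}{\mathfrak{p}}\right\rceil+1 .$$
   Context: $\mathbb{C}\{x,y\}$ denotes the ring of convergent power series in $(x,y)$ centered at $(0,0)$. A function $f$ is in $L^{\mathfrak{p}}_{loc}$ if it is defined on some neighborhood $U$ of $(0,0)$ in $\mathbb{R}^2$ and belongs to $L^{\mathfrak{p}}(U)$ with respect to Lebesgue measure. For a function $P$, $\mathcal{I}^{\mathfrak{p}}_P=\{Q\in\mathbb{C}\{x,y\}: Q/P\in L^{\mathfrak{p}}_{loc}\}$. For $Q\in\mathbb{C}\{x,y\}$, $q\in\mathbb{C}[x]$, $n\in\mathbb{N}$, $O(n,q,Q)$ denotes the largest $k$ such that $x^k$ divides $Q(x,x^ny-q(x))$. ''Ord'' of a one-variable power series is its order of vanishing at $0$. Given data $L_1,\dots,L_M$, $q_1,\dots,q_M$, define $O_{ij}=\min\{\mathrm{Ord}(q_j-q_i),2L_j,2L_i\}$ (so $O_{jj}=2L_j$).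 *)

(* Defs.v *)
From HB Require Import structures.
From mathcomp Require Import all_boot all_order all_algebra.
From mathcomp Require Import all_classical all_reals all_analysis.
From mathcomp Require Import complex.
Set Implicit Arguments. Unset Strict Implicit. Unset Printing Implicit Defensive.
Import Order.TTheory GRing.Theory Num.Theory.
Local Open Scope ring_scope.
Local Open Scope complex_scope.
Local Open Scope classical_set_scope.

(* A (formal) double power series in (x,y) with complex coefficients
   c i j = coefficient of x^i y^j. *)
Definition cpseries (R : realType) := nat -> nat -> R[i].

Definition cmod (R : realType) (z : R[i]) : R := Num.sqrt (complex.Re z ^+ 2 + complex.Im z ^+ 2).

(* Membership in C{x,y}: the series converges absolutely on some polydisc
   of radius r > 0. *)
Definition ps_convergent (R : realType) (c : cpseries R) : Prop :=
  exists r : R, 0 < r /\ exists B : R, forall N : nat,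
    \sum_(i < N) \sum_(j < N) cmod (c i j) * r ^+ (i + j) <= B.

Definition ps_eval (R : realType) (c : cpseries R) (x y : R) : R[i] :=
  Complex
    (limn (fun N : nat => \sum_(i < N) \sum_(j < N) complex.Re (c i j) * x ^+ i * y ^+ j))
    (limn (fun N : nat => \sum_(i < N) \sum_(j < N) complex.Im (c i j) * x ^+ i * y ^+ j)).

Definition Lp_loc (R : realType) (p : R)
    (f : (R * R)%type -> R[i]) : Prop :=
  exists U : set (R * R)%type,
    (exists e : R, 0 < e /\ [set z | `|z.1| < e /\ `|z.2| < e] `<=` U) /\
    measurable U /\
    measurable_fun U (fun z => complex.Re (f z)) /\
    measurable_fun U (fun z => complex.Im (f z)) /\
    (\int[(@lebesgue_measure R \x @lebesgue_measure R)%E]_(z in U) ((cmod (f z)) `^ p)%:E < +oo)%E.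

Definition xpow_divides (R : realType) (k n : nat) (q : {poly R}) (Q : cpseries R)
  : Prop :=
  exists G : cpseries R, ps_convergent G /\
    exists e : R, 0 < e /\ forall x y : R, `|x| < e -> `|y| < e ->
      ps_eval Q x (x ^+ n * y - q.[x]) = (x ^+ k)%:C * ps_eval G x y.

Definition Onq (R : realType) (n : nat) (q : {poly R}) (Q : cpseries R) : \bar R :=
  ereal_sup [set (k%:R)%:E | k in [set k : nat | xpow_divides k n q Q]].

(* Order of vanishing at 0 of a nonzero polynomial: index of the first nonzero
   coefficient. *)
Definition ordp (R : realType) (p : {poly R}) : nat := find (fun a => a != 0) p.

(* O_ij = min{Ord(q_j - q_i), 2L_j, 2L_i}, with Ord(0) = +oo. *)
Definition Oij (R : realType) (M : nat) (L : 'I_M -> nat) (q : 'I_M -> {poly R})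
  (i j : 'I_M) : nat :=
  if q j - q i == 0 then minn (2 * L j) (2 * L i)
  else minn (ordp (q j - q i)) (minn (2 * L j) (2 * L i)).

Definition Pval (R : realType) (M : nat) (L : 'I_M -> nat) (q : 'I_M -> {poly R})
  (x y : R) : R[i] :=
  \prod_(j < M) ((y + (q j).[x]) +i* (x ^+ (2 * L j))).

(* Main.v *)
Require Import Defs.
From HB Require Import structures.
From mathcomp Require Import all_boot all_order all_algebra.
From mathcomp Require Import all_classical all_reals all_analysis.
From mathcomp Require Import measurable_realfun.
From mathcomp Require Import complex lra ring zify.
Set Implicit Arguments.
Unset Strict Implicit.
Unset Printing Implicit Defensive.
Import Order.TTheory GRing.Theory Num.Theory.
Import numFieldTopology.Exports numFieldNormedType.Exports.
Local Open Scope ring_scope.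
Local Open Scope classical_set_scope.

(** On the region [y = x^(2 L_j) t - q_j(x)] with [t] bounded, [|P|]
    is at most a constant times [|x|^S_j], [S_j] being the sum of the [O_ij],
    while [Q] has size [|x|^K] for generic [t], [K] being the order
    [O(2 L_j, q_j, Q)]; that region has width [|x|^(2 L_j)] in [y], so
    integrability forces [(S_j - K) p < 2 L_j + 1], which is the stated
    inequality.

    Conversely, the same inequality is needed at every intermediate scale
    [y = x^m t - q_j(x)], [m <= 2 L_j].  If it failed at some scale, take the
    coarsest one: there the leading form of [Q] has degree less than the number
    of branches through that scale, so it vanishes to too low an order along
    one of the groups into which these branches split, and the failure
    propagates to the finer scale along that group, until it reaches the end of
    a branch, a contradiction.  The inequalities at all scales bound
    [|Q / P|^p] near the branch [j] closest to [(x, y)] by a constant times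
    [(|x| |y + q_j(x)|)^-theta] with [theta < 1], which is integrable.

    Everything is done on the real and imaginary parts of [Q] truncated to
    polynomials in [y] over [R[x]]: in [{poly {poly R}}] the inner variable is
    [x], so [P`_b`_a] is the coefficient of [x^a y^b]. *)

(** * Leading forms at intermediate scales *)

(** Let [X = |x|] and [U = |y + q_j(x)|], with [j] the branch closest to the point. Up to a
    constant, [|P|] is at least the product over [i] of [max(X^(O_ij), U)]. In logarithmic
    coordinates the bound wanted for a monomial [X^a U^b] is therefore linear between the
    consecutive scales [U = X^m] and [U = X^(m+1)], so it need only be checked at the integers
    [m <= 2 L_j]. Only finitely many strict inequalities are involved, so a single [l < 1/p]
    satisfies them all with room to spare, and [theta = l p].

    A failure persists at finer scales because the excess of the order of [P] over that of [Q] then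
    grows by at least one, while the width of the region gains only one power of [x]; [p >= 1] makes
    the former outweigh the latter.

    For sufficiency, truncating [Q] at [S + 1], with [S] the sum of the [2 L_i], is harmless: the
    order of [P] never exceeds [S] at any scale [m <= 2 L_j], so the remainder satisfies every
    inequality trivially. *)

Lemma drop_poly_low0 (R : comNzRingType) K (g : {poly R}) :
  (forall a, (a < K)%N -> g`_a = 0) -> g = 'X^K * drop_poly K g.
Proof.
move=> g0; rewrite -[LHS](poly_take_drop K) [X in X + _](_ : _ = 0).
  by rewrite add0r mulrC.
by apply/polyP => a; rewrite coef_take_poly coef0; case: ifP => // /g0.
Qed.

Section Forms.
Variable R : idomainType.
Implicit Types (P V : {poly {poly R}}) (r : {poly R}).

(** The grading gives [x] weight 1 and [y] weight [m], the one adapted to the scale [y = x^m t]. *)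
Definition weight_ge (m K : nat) P := forall a b, (a + m * b < K)%N -> P`_b`_a = 0.

(** This is the weight-[K] part of [P] dehomogenised at [x = 1], a polynomial in [t]. The test
    [m * b <= K] guards against truncated subtraction. *)
Definition lead_form (m K : nat) P : {poly R} :=
  \poly_(b < size P) (if (m * b <= K)%N then P`_b`_(K - m * b) else 0).

Definition wsubst (m : nat) P : {poly {poly R}} := P \Po (('X^m)%:P * 'X).

Lemma coef_wsubst m P b : (wsubst m P)`_b = P`_b * 'X^(m * b).
Proof.
rewrite /wsubst comp_polyE coef_sum.
under eq_bigr => i _ do rewrite exprMn -rmorphXn -exprM coefZ coefCM coefXn.
have [bP|Pb] := ltnP b (size P).
  rewrite (bigD1 (Ordinal bP)) //= eqxx mulr1 big1 ?addr0 // => i /eqP ib.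
  by case: eqVneq => [bi|_]; [case: ib; apply: val_inj | rewrite !mulr0].
rewrite (nth_default _ Pb) mul0r big1 // => i _.
by case: eqVneq => [bi|_]; [move: (ltn_ord i); rewrite -bi ltnNge Pb | rewrite !mulr0].
Qed.

Lemma wsubst_factor m K P : weight_ge m K P -> exists V, wsubst m P = ('X^K)%:P * V.
Proof.
move=> wP; exists (\poly_(b < size P) drop_poly K (P`_b * 'X^(m * b))).
apply/polyP => b; rewrite coef_wsubst coefCM coef_poly.
case: ltnP => [_|Pb]; last by rewrite mulr0 (nth_default _ Pb) mul0r.
apply: drop_poly_low0 => a aK; rewrite coefMXn; case: ltnP => // mba; apply: wP; lia.
Qed.

(** Weight and leading form are read off a factorisation in the ring, the leading form being [V] at
    [x = 0]. Such a factorisation is carried along by substitutions, which coefficientwise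
    conditions are not. *)
Lemma factor_wsubst m K P V : wsubst m P = ('X^K)%:P * V ->
  weight_ge m K P /\ lead_form m K P = map_poly (horner_eval 0) V.
Proof.
move=> PV.
have PVb a b : (P`_b * 'X^(m * b))`_a = ('X^K * V`_b)`_a.
  by rewrite -coef_wsubst PV coefCM.
split.
  move=> a b abK; have := PVb (a + m * b)%N b.
  by rewrite coefMXn coefXnM abK ltnNge leq_addl /= addnK.
apply/polyP => b; rewrite coef_poly coef_map /= /horner_eval horner_coef0.
have := PVb K b; rewrite coefMXn coefXnM ltnn subnn => <-.
case: (ltnP K); case: ltnP => // Pb; rewrite ?if_same //.
by rewrite (nth_default _ Pb) coef0.
Qed.

(* Substituting [Y - r] with [r = x^m (s + ...)] only translates the leading
   form of weight [m]. *)
Lemma shift_form m K P r : (forall a, (a < m)%N -> r`_a = 0) -> weight_ge m K P ->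
  weight_ge m K (P \Po ('X - r%:P)) /\
  lead_form m K (P \Po ('X - r%:P)) = lead_form m K P \Po ('X - (r`_m)%:P).
Proof.
move=> r0 /[dup] wP /wsubst_factor[V PV].
have rE : r = 'X^m * drop_poly m r := drop_poly_low0 r0.
have : wsubst m (P \Po ('X - r%:P)) = ('X^K)%:P * (V \Po ('X - (drop_poly m r)%:P)).
  rewrite /wsubst -comp_polyA rmorphB /= comp_polyX comp_polyC.
  have -> : ('X^m)%:P * 'X - r%:P =
    (('X^m)%:P * 'X) \Po ('X - (drop_poly m r)%:P).
    by rewrite rmorphM /= comp_polyC comp_polyX {1}rE mulrBr rmorphM.
  by rewrite comp_polyA -/(wsubst m P) PV rmorphM /= comp_polyC.
move=> /factor_wsubst[? ->]; split=> //.
have [_ ->] := factor_wsubst PV.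
rewrite map_comp_poly /= rmorphB /= map_polyX map_polyC /= /horner_eval.
by rewrite horner_coef0 coef_drop_poly.
Qed.

End Forms.

(** Powers of distinct linear factors are coprime, so divisibility by each one with its multiplicity
    is enough. This is the degree count behind [bad_split]. *)
Lemma prod_XsubC_dvdp (F : fieldType) (s : seq F) (g : {poly F}) :
  (forall v, v \in s -> ('X - v%:P) ^+ count_mem v s %| g) ->
  \prod_(v <- s) ('X - v%:P) %| g.
Proof.
move=> sg; rewrite -prodr_undup_exp_count.
have : {subset undup s <= s} by move=> v; rewrite mem_undup.
elim: (undup s) (undup_uniq s) => [|v t IH] /=; first by rewrite big_nil dvd1p.
move=> /andP[vt ut] ts; rewrite big_cons Gauss_dvdp.
  by rewrite sg ?ts ?mem_head //= IH // => w wt; apply: ts; rewrite inE wt orbT.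
rewrite big_seq; apply/coprimep_expl; apply: (big_ind (coprimep _)).
- by rewrite coprimep1.
- by move=> x y cx cy; rewrite coprimepMr cx.
move=> w wt; apply/coprimep_expr; rewrite coprimep_XsubC root_XsubC.
by apply: contra vt => /eqP <-.
Qed.

Lemma dvdp_Xn_coef (F : fieldType) N (g : {poly F}) :
  (forall a, (a < N)%N -> g`_a = 0) -> 'X^N %| g.
Proof. by move=> /drop_poly_low0 ->; rewrite dvdp_mulr. Qed.

Section Scales.
Variables (R : realFieldType) (M : nat) (n : 'I_M -> nat) (q : 'I_M -> {poly R}).
Variables (O : 'I_M -> 'I_M -> nat) (p : R) (C : {poly {poly R}}).
Hypothesis p1 : 1 <= p.
(** For fixed [m], the relation [m <= O i j] is an equivalence on the branches that reach scale [m];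
    its classes are the clusters, nested as [m] grows. *)
Hypothesis OP : forall i j m, (m <= O i j)%N <->
  [/\ (m <= n j)%N, (m <= n i)%N & forall a, (a < m)%N -> (q j)`_a = (q i)`_a].

Definition branch j := C \Po ('X - (q j)%:P).
(** For [m <= n j], the order in [x] of [P] along [y = x^m t - q_j(x)] for generic [t]. *)
Definition scale_sum m j := (\sum_(i < M) minn (O i j) m)%N.
(** If [|Q / P|] is of size [|x|^-s] on a region of width [|x|^m] in [y], integrability of its
    [p]-th power means [m - s p > -1]. *)
Definition good (m s : nat) : bool := s%:R * p < m.+1%:R.

Lemma good_le m s t : (s <= t)%N -> good m t -> good m s.
Proof.
move=> st; apply: le_lt_trans; apply: ler_wpM2r; rewrite ?ler_nat //; exact: le_trans ler01 p1.
Qed.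

Lemma O_sym m i j : (m <= O i j)%N -> (m <= O j i)%N.
Proof. by move=> /OP[? ? H]; apply/OP; split=> // a /H. Qed.

Lemma O_trans m i j k : (m <= O i j)%N -> (m <= O j k)%N -> (m <= O i k)%N.
Proof.
move=> /OP[_ ? H] /OP[? _ H']; apply/OP; split=> // a am.
by rewrite H' // H.
Qed.

Lemma scale_sumS m j :
  scale_sum m.+1 j = (scale_sum m j + #|[pred i | (m < O i j)%N]|)%N.
Proof.
rewrite /scale_sum -sum1_card [X in (_ + X)%N]big_mkcond -big_split /=.
by apply: eq_bigr => i _; rewrite inE; case: ifP; lia.
Qed.

(** Contact orders are ultrametric: two branches that agree up to scale [m] have the same contact
    with any third one, once capped at [m]. *)
Lemma scale_sum_cluster m i j : (m <= O i j)%N -> scale_sum m i = scale_sum m j.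
Proof.
move=> mij; apply: eq_bigr => l _; apply/eqP; rewrite eqn_leq !leq_min !geq_minr !andbT.
by rewrite (@O_trans _ l i j) ?geq_minl ?(leq_trans _ mij) ?geq_minr //=;
  rewrite (@O_trans _ l j i) ?geq_minl // O_sym // (leq_trans _ mij) ?geq_minr.
Qed.

Lemma branch_shift i j : branch i = branch j \Po ('X - (q i - q j)%:P).
Proof.
rewrite /branch; have -> : 'X - (q i)%:P = ('X - (q j)%:P) \Po ('X - (q i - q j)%:P).
  by rewrite comp_polyB comp_polyX comp_polyC polyCB opprB addrA [RHS]addrAC addrK.
exact: comp_polyA.
Qed.

Hypothesis cond : forall j a b, (branch j)`_b`_a != 0 ->
  good (n j) (scale_sum (n j) j - (a + n j * b)).

(** A failure of the inequality, together with the bound on the degree of the leading form (less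
    than the size of the cluster) that lets it be passed on to the next scale. *)
Definition bad m j K := [/\ weight_ge m K (branch j), lead_form m K (branch j) != 0,
  (size (lead_form m K (branch j)) <= #|[pred i | (m <= O i j)%N]|)%N &
  ~~ good m (scale_sum m j - K)].

Lemma lead_form_coef m K (P : {poly {poly R}}) b : (lead_form m K P)`_b != 0 ->
  [/\ (m * b <= K)%N, P`_b`_(K - m * b) != 0 &
      (lead_form m K P)`_b = P`_b`_(K - m * b)].
Proof.
rewrite coef_poly; case: ltnP => [_|]; last by rewrite eqxx.
by case: leqP => //; rewrite eqxx.
Qed.

Lemma lead_formE m K (P : {poly {poly R}}) a b : (a + m * b)%N = K ->
  P`_b`_a != 0 -> (lead_form m K P)`_b = P`_b`_a.
Proof.
move=> <- Pab; rewrite coef_poly leq_addl addnK; case: ltnP => // Pb.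
by move: Pab; rewrite (nth_default _ Pb) coef0 eqxx.
Qed.

Lemma lead_form_exists m (P : {poly {poly R}}) a b : P`_b`_a != 0 ->
  exists K, [/\ (K <= a + m * b)%N, weight_ge m K P & lead_form m K P != 0].
Proof.
move=> Pab.
pose pr (K : nat) := [exists b' : 'I_(size P), exists a' : 'I_(size (P`_b')%R),
   (a' + m * b' == K)%N && (P`_b'`_a' != 0)].
have prP a' b' : P`_b'`_a' != 0 -> pr (a' + m * b')%N.
  move=> Pab'.
  have sb : (b' < size P)%N.
    by rewrite ltnNge; apply: contra Pab' => /(nth_default _) ->; rewrite coef0.
  have sa : (a' < size (P`_b')%R)%N.
    by rewrite ltnNge; apply: contra Pab' => /(nth_default _) ->.
  by apply/existsP; exists (Ordinal sb); apply/existsP; exists (Ordinal sa); rewrite eqxx.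
have exK : exists K, pr K by exists (a + m * b)%N; apply: prP.
case: (ex_minnP exK) => K /existsP[b' /existsP[a' /andP[/eqP abK Pab']]] Kmin.
exists K; split.
- exact/Kmin/prP.
- move=> a1 b1; rewrite ltnNge => /negP; case: (eqVneq P`_b1`_a1 0) => // /prP/Kmin //.
- apply/eqP => /(congr1 (fun g : {poly R} => g`_b')).
  by rewrite (lead_formE abK Pab') coef0; apply/eqP.
Qed.

Lemma cluster_form m i j K : (m <= O i j)%N -> weight_ge m K (branch j) ->
  weight_ge m K (branch i) /\
  lead_form m K (branch i) = lead_form m K (branch j) \Po ('X - ((q i - q j)`_m)%:P).
Proof.
move=> /OP[_ _ qij] wK; rewrite (branch_shift i j); apply: shift_form => // a /qij.
by rewrite coefB => ->; rewrite subrr.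
Qed.

Lemma lead_form_neq0 m K (P : {poly {poly R}}) : lead_form m K P != 0 ->
  exists b, (lead_form m K P)`_b != 0.
Proof. by move=> nz; exists (size (lead_form m K P)).-1; rewrite -lead_coefE lead_coef_eq0. Qed.

(** If a branch of the cluster ended at scale [m], [cond] for that branch, applied to a monomial of
    weight [K] in its leading form, would contradict the failure. *)
Lemma bad_not_end m j K i : bad m j K -> (m <= O i j)%N -> (m < n i)%N.
Proof.
move=> [wK nz _ ng] mij; have [_ mi _] := (OP i j m).1 mij.
rewrite ltn_neqAle mi andbT; apply/eqP => mE.
have [_ fE] := cluster_form mij wK.
have nzi : lead_form m K (branch i) != 0.
  by rewrite fE comp_poly_eq0 // size_XsubC.
have [b /lead_form_coef[mb nzb _]] := lead_form_neq0 nzi.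
move/negP: ng; apply; rewrite -(scale_sum_cluster mij).
by have := cond nzb; rewrite -mE subnK.
Qed.

(* The branches of the cluster split into groups according to their
   coefficient of [x^m]; a leading form of degree smaller than the size of the
   cluster vanishes, for one of the groups, to order less than the size of
   that group. *)
Lemma bad_split m j K : bad m j K -> exists i, (m <= O i j)%N /\
  exists mu, (mu < #|[pred l | (m < O l i)%N]|)%N /\ (lead_form m K (branch i))`_mu != 0.
Proof.
move=> B; have [wK nz sz ng] := B.
have [/existsP[i /andP[mij /existsP[mu nzmu]]]|noi] := boolP [exists i, (m <= O i j)%N &&
  [exists mu : 'I_#|[pred l | (m < O l i)%N]|, (lead_form m K (branch i))`_mu != 0]].
  by exists i; split=> //; exists mu; split.
pose v i := (q i - q j)`_m.
pose s := [seq - v i | i <- enum [pred i | (m <= O i j)%N]].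
have : \prod_(x <- s) ('X - x%:P) %| lead_form m K (branch j).
  apply: prod_XsubC_dvdp => w /mapP[i iC ->] {w}.
  have mij : (m <= O i j)%N by move: iC; rewrite mem_enum inE.
  (* Two branches of the cluster give the same root exactly when they also agree at [x^m]; since
     neither ends at [m], this means contact greater than [m]. *)
  have -> : count_mem (- v i) s = #|[pred l | (m < O l i)%N]|.
    rewrite count_map -sum1_count big_enum_cond -sum1_card; apply: eq_bigl => l.
    rewrite !inE /= eqr_opp /v !coefB (inj_eq (addIr _)).
    apply/andP/idP => [[mlj /eqP qm]|mli].
      have /OP[_ _ H] := O_trans mlj (O_sym mij).
      apply/OP; rewrite (bad_not_end B mlj) (bad_not_end B mij); split=> // a.
      by rewrite ltnS leq_eqVlt => /predU1P[->|/H].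
    have /OP[_ _ H] := mli; rewrite (O_trans (ltnW mli) mij); split=> //.
    by rewrite H.
  have : 'X^#|[pred l | (m < O l i)%N]| %| lead_form m K (branch i).
    apply: dvdp_Xn_coef => mu muN; apply/eqP; apply: contraNT noi => nzmu.
    by apply/existsP; exists i; rewrite mij; apply/existsP; exists (Ordinal muN).
  have [_ ->] := cluster_form mij wK.
  (* Translating back turns vanishing at 0 for branch [i] into vanishing at [- v i] for branch
     [j]. *)
  move=> /(dvdp_comp_poly ('X + (v i)%:P)).
  rewrite comp_Xn_poly -comp_polyA rmorphB /= comp_polyX comp_polyC addrK comp_polyXr.
  by rewrite rmorphN opprK.
move=> /(dvdp_leq nz); rewrite size_prod_XsubC size_map -cardE => /leq_trans /(_ sz).
by rewrite ltnn.
Qed.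

(** The monomial of degree [mu] found by [bad_split] has weight [K + mu] at scale [m + 1], so
    [K' <= K + mu]. The order of [P] grows by the size [N > mu] of the group, hence the excess grows
    by at least 1, and [p >= 1] keeps the inequality false. *)
Lemma bad_step m j K : bad m j K -> exists i K', bad m.+1 i K'.
Proof.
move=> B; have [wK nz sz ng] := B.
have [i [mij [mu [muN /lead_form_coef[mmu nzmu _]]]]] := bad_split B.
have [wKi _] := cluster_form mij wK.
have [K' [K'le wK' nz']] := lead_form_exists m.+1 nzmu.
have K'K : (K' <= K + mu)%N by lia.
exists i, K'; split=> //.
  (* A monomial of weight [K'] at scale [m + 1] and degree [b] has weight [K' - b] at scale [m].
     This is at least [K], so [b <= K' - K <= mu < N]. *)
  apply/leq_sizeP => b Nb; apply/eqP; apply: contraT => /lead_form_coef[mb nzb _].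
  by move: nzb; rewrite (wKi (K' - m.+1 * b) b)%N ?eqxx //; lia.
move: ng; rewrite /good -!leNgt scale_sumS (scale_sum_cluster mij).
set S := scale_sum m j; set N := #|_| in muN * => h.
have SK : (0 < S - K)%N.
  by rewrite lt0n; apply: contraTneq h => ->; rewrite mul0r -ltNge ltr0n.
have : ((S - K).+1%:R * p <= (S + N - K')%:R * p :> R).
  by apply: ler_wpM2r; rewrite ?ler_nat ?(le_trans ler01 p1) //; lia.
apply: le_trans; rewrite -[m.+2%:R]natr1 -[(S - K).+1%:R]natr1 mulrDl mul1r; exact: lerD.
Qed.

(** The cluster is nonempty because the leading form is nonzero, and none of its branches ends at
    [m]. So [m] stays below the sum of the [n i], while [bad_step] would raise it forever. *)
Lemma not_bad m j K : ~ bad m j K.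
Proof.
have bound m' j' K' : bad m' j' K' -> (m' < \sum_i n i)%N.
  move=> B; have [_ nz sz _] := B.
  have /card_gt0P[l mi] : (0 < #|[pred i | (m' <= O i j')%N]|)%N.
    by apply: leq_trans sz; rewrite size_poly_gt0.
  apply: leq_trans (bad_not_end B mi) _.
  by rewrite (bigD1 l) //= leq_addr.
have [k le_k] := ubnP (\sum_i n i - m)%N.
elim: k m j K le_k => // k IH m j K le_k B; have := bound _ _ _ B.
have [i [K' B']] := bad_step B => mb; apply: (IH _ _ _ _ B'); lia.
Qed.

Lemma scale_good m j a b : (m <= n j)%N -> (branch j)`_b`_a != 0 ->
  good m (scale_sum m j - (a + m * b)).
Proof.
elim: m j a b => [|m IH] j a b mn nz.
  rewrite /good /scale_sum big1 ?sub0n ?mul0r ?ltr01 // => i _; exact: minn0.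
apply: contraT => ng.
have [K [Kle wK nzK]] := lead_form_exists m.+1 nz.
have ngK : ~~ good m.+1 (scale_sum m.+1 j - K).
  by apply: contra ng; apply: good_le; rewrite leq_sub2l.
exfalso; apply: (@not_bad m.+1 j K); split=> //.
(* The inequality holds at [m] and fails at [m + 1]. A monomial of degree [b' >= N] in the leading
   form would have weight only [K - b'] at scale [m], hence at least the same excess there,
   contradicting the inequality at [m]. *)
apply/leq_sizeP => b' Nb; apply/eqP; apply: contraT => /lead_form_coef[mb nzb _].
have := IH j _ _ (ltnW mn) nzb; move: ngK.
rewrite scale_sumS /good -leNgt; set S := scale_sum m j; set N := #|_| in Nb *.
move=> h1 h2.
have SK : (0 < S + N - K)%N.
  by rewrite lt0n; apply: contraTneq h1 => ->; rewrite mul0r -ltNge ltr0n.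
have h3 : ((S + N - K)%:R * p <= (S - (K - m.+1 * b' + m * b'))%:R * p :> R).
  by apply: ler_wpM2r; rewrite ?ler_nat ?(le_trans ler01 p1) //; lia.
by move: (le_lt_trans h3 h2); rewrite ltNge (le_trans _ h1) // ler_nat.
Qed.

End Scales.

(** * Absolutely convergent double power series *)

Section SquareSums.
Variable R : realType.
Implicit Types (f g c : nat -> nat -> R).

(** Square partial sums are used because [ps_eval] and [ps_convergent] are defined by them. *)
Definition sqsum f (N : nat) : R := \sum_(i < N) \sum_(j < N) f i j.

Lemma sqsumS f N :
  sqsum f N.+1 = sqsum f N + (\sum_(i < N) f i N + \sum_(j < N.+1) f N j).
Proof.
rewrite /sqsum big_ord_recr /= addrA; congr (_ + _).
by rewrite -big_split; apply: eq_bigr => i _; rewrite big_ord_recr.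
Qed.

Lemma eq_sqsum f g N : (forall i j, f i j = g i j) -> sqsum f N = sqsum g N.
Proof. by move=> fg; apply: eq_bigr => i _; apply: eq_bigr => j _. Qed.

Lemma sqsumD f g N : sqsum (fun i j => f i j + g i j) N = sqsum f N + sqsum g N.
Proof. by rewrite /sqsum -big_split; apply: eq_bigr => i _; rewrite big_split. Qed.

Lemma sqsumN f N : sqsum (fun i j => - f i j) N = - sqsum f N.
Proof. by rewrite /sqsum -sumrN; apply: eq_bigr => i _; rewrite sumrN. Qed.

Lemma sqsumZ (a : R) f N : sqsum (fun i j => a * f i j) N = a * sqsum f N.
Proof. by rewrite /sqsum mulr_sumr; apply: eq_bigr => i _; rewrite mulr_sumr. Qed.

Lemma ler_sqsum f g N : (forall i j, f i j <= g i j) -> sqsum f N <= sqsum g N.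
Proof. by move=> fg; apply: ler_sum => i _; apply: ler_sum => j _. Qed.

Lemma sqsum_homo f : (forall i j, 0 <= f i j) -> nondecreasing_seq (sqsum f).
Proof.
move=> f0; apply/nondecreasing_seqP => N; rewrite sqsumS lerDl addr_ge0 //;
  exact: sumr_ge0.
Qed.

(** Both [g + f] and [g - f] have nonnegative terms, so their square sums increase with [N]. *)
Lemma sqsum_dist f g N N' : (forall i j, `|f i j| <= g i j) -> (N <= N')%N ->
  `|sqsum f N' - sqsum f N| <= sqsum g N' - sqsum g N.
Proof.
move=> fg NN'.
have h1 : sqsum (fun i j => g i j + f i j) N <= sqsum (fun i j => g i j + f i j) N'.
  by apply: sqsum_homo => // i j; have := fg i j; rewrite ler_norml => /andP[]; lra.
have h2 : sqsum (fun i j => g i j + - f i j) N <= sqsum (fun i j => g i j + - f i j) N'.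
  by apply: sqsum_homo => // i j; have := fg i j; rewrite ler_norml => /andP[]; lra.
by move: h1 h2; rewrite !sqsumD !sqsumN ler_norml => *; apply/andP; split; lra.
Qed.

Lemma sqsum_ge0_cvg g B : (forall i j, 0 <= g i j) -> (forall N, sqsum g N <= B) ->
  cvgn (sqsum g).
Proof.
move=> g0 gB; apply: nondecreasing_is_cvgn; first exact: sqsum_homo.
by exists B => _ [N _ <-].
Qed.

Lemma sqsum_cvg f g B : (forall i j, `|f i j| <= g i j) ->
  (forall N, sqsum g N <= B) -> cvgn (sqsum f).
Proof.
move=> fg gB; have g0 i j : 0 <= g i j := le_trans (normr_ge0 _) (fg i j).
have h1 : cvgn (sqsum g) := sqsum_ge0_cvg g0 gB.
have h2 : cvgn (sqsum (fun i j => g i j + f i j)).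
  apply: (@sqsum_ge0_cvg _ (B + B)) => [i j|N].
    by have := fg i j; rewrite ler_norml => /andP[]; lra.
  rewrite (le_trans (ler_sqsum (g := fun i j => g i j + g i j) _ _)) //.
    by move=> i j; rewrite lerD2l (le_trans (ler_norm _)).
  by rewrite sqsumD lerD.
have -> : sqsum f = sqsum (fun i j => g i j + f i j) - sqsum g.
  by apply/funext => N; rewrite -[RHS]/(_ - _) sqsumD addrAC subrr add0r.
exact: is_cvgB.
Qed.

Lemma sqsum_lim_dist f g B N : (forall i j, `|f i j| <= g i j) ->
  (forall N, sqsum g N <= B) -> `|limn (sqsum f) - sqsum f N| <= limn (sqsum g) - sqsum g N.
Proof.
move=> fg gB; have g0 i j : 0 <= g i j := le_trans (normr_ge0 _) (fg i j).
have cf := sqsum_cvg fg gB; have cg := sqsum_ge0_cvg g0 gB.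
have h1 : (fun n => `|sqsum f n - sqsum f N|) @ \oo --> `|limn (sqsum f) - sqsum f N|.
  by apply: cvg_norm; apply: cvgB => //; apply: cvg_cst.
have h2 : (fun n => sqsum g n - sqsum g N) @ \oo --> limn (sqsum g) - sqsum g N.
  by apply: cvgB => //; apply: cvg_cst.
rewrite -(cvg_lim _ h1) // -(cvg_lim _ h2) //.
apply: ler_lim; [exact: cvgP h1|exact: cvgP h2|].
by exists N => // n /= Nn; exact: sqsum_dist.
Qed.

Lemma sqsum_lim_le g B : (forall i j, 0 <= g i j) ->
  (forall N, sqsum g N <= B) -> limn (sqsum g) <= B.
Proof. by move=> g0 gB; apply: limr_le; [exact: sqsum_ge0_cvg g0 gB|exact: nearW gB]. Qed.

Lemma sqsum_stable g D N : (forall i j, (D <= i)%N || (D <= j)%N -> g i j = 0) ->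
  (D <= N)%N -> sqsum g N = sqsum g D.
Proof.
move=> g0; elim: N => [|N IH]; first by rewrite leqn0 => /eqP ->.
rewrite leq_eqVlt => /predU1P[->//|DN]; rewrite sqsumS IH // !big1 ?addr0 // => i _.
  by apply: g0; lia.
by apply: g0; lia.
Qed.

Definition rconv c (r B : R) := forall N, sqsum (fun i j => `|c i j| * r ^+ (i + j)) N <= B.

Definition rpeval c (x y : R) : R := limn (sqsum (fun i j => c i j * x ^+ i * y ^+ j)).

Lemma mono_le c r x y i j : 0 <= r -> `|x| <= r -> `|y| <= r ->
  `|c i j * x ^+ i * y ^+ j| <= `|c i j| * r ^+ (i + j).
Proof.
move=> r0 xr yr; rewrite !normrM !normrX exprD mulrA.
by rewrite ler_pM ?mulr_ge0 ?exprn_ge0 // ?ler_wpM2l ?lerXn2r ?nnegrE.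
Qed.

Lemma rpeval_cvg c r B x y : 0 <= r -> rconv c r B -> `|x| <= r -> `|y| <= r ->
  cvgn (sqsum (fun i j => c i j * x ^+ i * y ^+ j)).
Proof. by move=> r0 cB xr yr; exact: (sqsum_cvg (fun i j => mono_le c i j r0 xr yr) cB). Qed.

Lemma rpeval_bound c r B x y : 0 <= r -> rconv c r B -> `|x| <= r -> `|y| <= r ->
  `|rpeval c x y| <= B.
Proof.
move=> r0 cB xr yr.
have := sqsum_lim_dist 0 (fun i j => mono_le c i j r0 xr yr) cB.
have s0 f : sqsum f 0 = 0 by rewrite /sqsum big_ord0.
rewrite !s0 !subr0 => /le_trans; apply; apply: (sqsum_lim_le _ cB) => i j.
by rewrite mulr_ge0 ?exprn_ge0.
Qed.

Lemma rconv_mono c r r' B : 0 <= r' -> r' <= r -> rconv c r B -> rconv c r' B.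
Proof.
move=> r'0 rr' cB N; apply: le_trans (cB N); apply: ler_sqsum => i j.
by rewrite ler_wpM2l // lerXn2r ?nnegrE // (le_trans r'0).
Qed.

(** Every monomial outside the square has [i >= D] or [j >= D], so a factor [(|x| / r)^D] or
    [(|y| / r)^D] can be taken out, leaving a term of the majorant series at [r]. *)
Lemma trunc_bound c r B D x y : 0 < r -> rconv c r B -> `|x| <= r -> `|y| <= r ->
  `|rpeval c x y - sqsum (fun i j => c i j * x ^+ i * y ^+ j) D| <=
    r ^- D * B * (`|x| ^+ D + `|y| ^+ D).
Proof.
move=> r0 cB xr yr; have r0' := ltW r0.
(* The tail, written as a double series whose [D]-th square sum is 0. *)
pose f i j := if (i < D)%N && (j < D)%N then 0 else c i j * x ^+ i * y ^+ j.
pose A := r ^- D * (`|x| ^+ D + `|y| ^+ D).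
have A0 : 0 <= A by rewrite mulr_ge0 ?addr_ge0 ?invr_ge0 ?exprn_ge0.
have fA i j : `|f i j| <= A * (`|c i j| * r ^+ (i + j)).
  rewrite /f; case: ifPn => [_|ij]; first by rewrite normr0 mulr_ge0 // mulr_ge0 // exprn_ge0.
  rewrite !normrM !normrX mulrCA -mulrA; apply: ler_wpM2l => //.
  have key k (u : R) : (D <= k)%N -> 0 <= u <= r -> u ^+ k <= r ^- D * u ^+ D * r ^+ k.
    move=> Dk /andP[u0 ur]; rewrite -(subnK Dk) !exprD.
    rewrite [r ^- D * _]mulrC !mulrA mulrAC mulfVK ?expf_neq0 ?gt_eqF // mulrC.
    by rewrite ler_wpM2l ?exprn_ge0 // lerXn2r ?nnegrE.
  have le1 (u : R) k : 0 <= u <= r -> u ^+ k <= r ^+ k.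
    by move=> /andP[u0 ur]; rewrite lerXn2r ?nnegrE.
  move: ij; rewrite negb_and -!leqNgt => /orP[Di|Dj].
    apply: (@le_trans _ _ (r ^- D * `|x| ^+ D * r ^+ i * r ^+ j)).
      by apply: ler_pM; rewrite ?exprn_ge0 ?key ?le1 ?normr_ge0.
    rewrite -mulrA -exprD ler_wpM2r ?exprn_ge0 // ler_wpM2l ?invr_ge0 ?exprn_ge0 //.
    by rewrite lerDl exprn_ge0.
  apply: (@le_trans _ _ (r ^+ i * (r ^- D * `|y| ^+ D * r ^+ j))).
    by apply: ler_pM; rewrite ?exprn_ge0 ?key ?le1 ?normr_ge0.
  rewrite mulrCA -exprD ler_wpM2r ?exprn_ge0 // ler_wpM2l ?invr_ge0 ?exprn_ge0 //.
  by rewrite lerDr exprn_ge0.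
have fB N : sqsum (fun i j => A * (`|c i j| * r ^+ (i + j))) N <= A * B.
  by rewrite sqsumZ ler_wpM2l.
have fD : sqsum f D = 0.
  by rewrite /sqsum big1 // => i _; rewrite big1 // => j _; rewrite /f !ltn_ord.
have := sqsum_lim_dist D fA fB.
rewrite fD subr0.
have -> : limn (sqsum f) = rpeval c x y - sqsum (fun i j => c i j * x ^+ i * y ^+ j) D.
  apply/cvg_lim => //.
  have : (fun n => sqsum (fun i j => c i j * x ^+ i * y ^+ j) n -
      sqsum (fun i j => c i j * x ^+ i * y ^+ j) D) @ \oo -->
      rpeval c x y - sqsum (fun i j => c i j * x ^+ i * y ^+ j) D.
    by apply: cvgB; [exact: (rpeval_cvg r0' cB)|exact: cvg_cst].
  apply: cvg_trans; apply: near_eq_cvg; exists D => // n /= Dn.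
  pose g i j := if (i < D)%N && (j < D)%N then c i j * x ^+ i * y ^+ j else 0.
  have <- : sqsum g n = sqsum (fun i j => c i j * x ^+ i * y ^+ j) D.
    rewrite (@sqsum_stable _ D) //; last first.
      by move=> i j; rewrite /g; case: ifP => //; lia.
    by apply: eq_bigr => i _; apply: eq_bigr => j _; rewrite /g !ltn_ord.
  rewrite -sqsumN -sqsumD; apply: eq_sqsum => i j.
  by rewrite /f /g; case: ifP => _; rewrite ?subr0 ?subrr.
move=> /le_trans; apply.
have -> : sqsum (fun i j => A * (`|c i j| * r ^+ (i + j))) D =
    A * sqsum (fun i j => `|c i j| * r ^+ (i + j)) D by rewrite sqsumZ.
rewrite (le_trans (y := A * B)) //; last by rewrite /A mulrAC.
apply: le_trans (_ : limn (sqsum (fun i j => A * (`|c i j| * r ^+ (i + j)))) <= _).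
  rewrite gerBl mulr_ge0 // ?sumr_ge0 // => *; rewrite ?sumr_ge0 // => *.
  by rewrite mulr_ge0 ?exprn_ge0.
by apply: (sqsum_lim_le _ fB) => i j; rewrite mulr_ge0 // mulr_ge0 // exprn_ge0.
Qed.

End SquareSums.

(** * Rearranging a series of polynomials into a power series *)

Section Rearrangement.
Variable R : realType.
Implicit Types (P Pb : {poly {poly R}}) (c : nat -> nat -> R).

Definition ev P (x y : R) : R := P.[y%:P].[x].

Definition psq P (x y : R) (N : nat) : R := sqsum (fun a b => P`_b`_a * x ^+ a * y ^+ b) N.

Lemma psq_ev P : exists N0, forall N x y, (N0 <= N)%N -> psq P x y N = ev P x y.
Proof.
exists (maxn (size P) (\max_(b < size P) size (P`_b)%R)) => N x y.
rewrite geq_max => /andP[PN PbN].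
rewrite /ev /psq /sqsum (horner_coef_wide _ PN) horner_sum exchange_big /=.
apply: eq_bigr => b _; rewrite hornerM horner_exp hornerC.
have sb : (size (P`_b)%R <= N)%N.
  have [bP|Pb] := ltnP b (size P); last by rewrite nth_default // size_poly0.
  exact: leq_trans (leq_bigmax (Ordinal bP)) PbN.
by rewrite (horner_coef_wide _ sb) mulr_suml.
Qed.

Definition dominates P Pb := forall a b, `|P`_b`_a| <= Pb`_b`_a.

Lemma dominates_mul P Pb P' Pb' :
  dominates P Pb -> dominates P' Pb' -> dominates (P * P') (Pb * Pb').
Proof.
move=> dP dP' a b; rewrite !coefM !coef_sum (le_trans (ler_norm_sum _ _ _)) //.
apply: ler_sum => i _; rewrite !coefM (le_trans (ler_norm_sum _ _ _)) //.
by apply: ler_sum => k _; rewrite normrM ler_pM.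
Qed.

Lemma dominates1 : dominates 1 1.
Proof. by move=> a b; rewrite coef1; case: eqP => _; rewrite ?coef1 ?coef0 ?normr_nat ?normr0. Qed.

Lemma dominates_exp P Pb k : dominates P Pb -> dominates (P ^+ k) (Pb ^+ k).
Proof.
move=> dP; elim: k => [|k IH]; first by rewrite !expr0; exact: dominates1.
by rewrite !exprS; apply: dominates_mul.
Qed.

Definition low_order (d : nat) P := forall a b, (a + b < d)%N -> P`_b`_a = 0.

Lemma low_order_mul d e P P' : low_order d P -> low_order e P' -> low_order (d + e) (P * P').
Proof.
move=> lP lP' a b ab; rewrite coefM coef_sum big1 // => i _; rewrite coefM big1 // => k _.
have [di|id] := ltnP (k + i) d; first by rewrite lP ?mul0r.
by rewrite lP' ?mulr0 //; have := ltn_ord i; have := ltn_ord k; lia.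
Qed.

Lemma low_order_exp d P k : low_order d P -> low_order (d * k) (P ^+ k).
Proof.
move=> lP; elim: k => [|k IH]; first by move=> a b; rewrite muln0.
by rewrite exprS mulnS; apply: low_order_mul.
Qed.

Lemma psq_dominates P Pb (r x y : R) N : dominates P Pb -> 0 <= r -> `|x| <= r -> `|y| <= r ->
  `|psq P x y N| <= ev Pb r r.
Proof.
move=> dP r0 xr yr; have [N0 H] := psq_ev Pb.
rewrite -(H (maxn N0 N)) ?leq_maxl //.
apply: le_trans (_ : psq Pb r r N <= _).
  rewrite /psq /sqsum (le_trans (ler_norm_sum _ _ _)) //; apply: ler_sum => a _.
  rewrite (le_trans (ler_norm_sum _ _ _)) //; apply: ler_sum => b _.
  by rewrite !normrM !normrX !ler_pM ?mulr_ge0 ?exprn_ge0 // lerXn2r ?nnegrE.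
apply: sqsum_homo; last exact: leq_maxr.
by move=> a b; rewrite !mulr_ge0 ?exprn_ge0 // (le_trans _ (dP a b)).
Qed.

(** The coefficient of [x^a y^b] in the sum of the [c i j * E i j]. If [E i j] has order at least
    [i + j], indices beyond [a + b] contribute nothing, so this sum is finite. *)
Definition recombine c (E : nat -> nat -> {poly {poly R}}) (a b : nat) : R :=
  sqsum (fun i j => c i j * (E i j)`_b`_a) (a + b).+1.

Section Recombine.
Variables (c : nat -> nat -> R) (E Eb : nat -> nat -> {poly {poly R}}) (r B : R).
Hypothesis r0 : 0 <= r.
Hypothesis EEb : forall i j, dominates (E i j) (Eb i j).
Hypothesis lowE : forall i j, low_order (i + j) (E i j).
Hypothesis cB : forall N, sqsum (fun i j => `|c i j| * ev (Eb i j) r r) N <= B.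

Let evEb0 i j : 0 <= ev (Eb i j) r r.
Proof.
by have := psq_dominates 0 (@EEb i j) r0 (_ : `|0| <= r) (_ : `|0| <= r);
  rewrite normr0 => /(_ r0 r0); apply: le_trans.
Qed.

Lemma recombine_wide a b N : (a + b < N)%N ->
  recombine c E a b = sqsum (fun i j => c i j * (E i j)`_b`_a) N.
Proof.
move=> abN; rewrite [RHS](@sqsum_stable _ _ (a + b).+1) // => i j ij.
by rewrite lowE ?mulr0 //; lia.
Qed.

Lemma recombine_psum x y N :
  sqsum (fun a b => recombine c E a b * x ^+ a * y ^+ b) N =
  sqsum (fun i j => c i j * psq (E i j) x y N) (2 * N).
Proof.
transitivity (\sum_(a < N) \sum_(b < N) \sum_(i < 2 * N) \sum_(j < 2 * N)
    c i j * ((E i j)`_b`_a * x ^+ a * y ^+ b)).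
  apply: eq_bigr => a _; apply: eq_bigr => b _.
  rewrite (@recombine_wide _ _ (2 * N)); last by have := ltn_ord a; have := ltn_ord b; lia.
  rewrite /sqsum !mulr_suml; apply: eq_bigr => i _; rewrite !mulr_suml.
  by apply: eq_bigr => j _; rewrite !mulrA.
under eq_bigr => a _ do rewrite exchange_big /=.
rewrite exchange_big /=; apply: eq_bigr => i _.
under eq_bigr => a _ do rewrite exchange_big /=.
rewrite exchange_big /=; apply: eq_bigr => j _; rewrite /psq /sqsum mulr_sumr.
by apply: eq_bigr => a _; rewrite mulr_sumr.
Qed.

Lemma recombine_conv : rconv (recombine c E) r B.
Proof.
move=> N; apply: le_trans (cB (2 * N)).
apply: le_trans (_ : sqsum (fun i j => `|c i j| * psq (Eb i j) r r N) (2 * N) <= _).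
  rewrite -[leRHS](_ : sqsum (fun a b => \sum_(i < 2 * N) \sum_(j < 2 * N)
       `|c i j| * ((Eb i j)`_b`_a * r ^+ a * r ^+ b)) N = _).
    apply: ler_sum => a _; apply: ler_sum => b _.
    rewrite (@recombine_wide _ _ (2 * N)); last by have := ltn_ord a; have := ltn_ord b; lia.
    rewrite /sqsum exprD mulrA.
    apply: (@le_trans _ _ ((\sum_(i < 2 * N) \sum_(j < 2 * N) `|c i j| * (Eb i j)`_b`_a)
        * r ^+ a * r ^+ b)).
      rewrite !ler_wpM2r ?exprn_ge0 // (le_trans (ler_norm_sum _ _ _)) //.
      apply: ler_sum => i _; rewrite (le_trans (ler_norm_sum _ _ _)) //.
      by apply: ler_sum => j _; rewrite normrM ler_wpM2l // EEb.
    rewrite !mulr_suml; apply: ler_sum => i _; rewrite !mulr_suml.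
    by apply: ler_sum => j _; rewrite !mulrA.
  rewrite /sqsum; under eq_bigr => a _ do rewrite exchange_big /=.
  rewrite exchange_big /=; apply: eq_bigr => i _.
  under eq_bigr => a _ do rewrite exchange_big /=.
  rewrite exchange_big /=; apply: eq_bigr => j _; rewrite /psq /sqsum mulr_sumr.
  by apply: eq_bigr => a _; rewrite mulr_sumr.
apply: ler_sqsum => i j; rewrite ler_wpM2l //.
have dEb : dominates (Eb i j) (Eb i j).
  by move=> a b; rewrite ger0_norm // (le_trans _ (EEb i j a b)).
by rewrite (le_trans (ler_norm _)) // psq_dominates // ger0_norm.
Qed.

(** The two summations are exchanged by comparing both with the [N]-th partial sum. On the first [N]
    indices each [psq] eventually equals [ev], and the other indices are dominated by the tail of
    [g], whatever the truncation of the [E i j]. *)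
Lemma recombine_ev x y : `|x| <= r -> `|y| <= r ->
  rpeval (recombine c E) x y = limn (sqsum (fun i j => c i j * ev (E i j) x y)).
Proof.
move=> xr yr.
set g := fun i j => `|c i j| * ev (Eb i j) r r.
have g0 i j : 0 <= g i j by rewrite mulr_ge0.
have fg N i j : `|c i j * psq (E i j) x y N| <= g i j.
  by rewrite normrM ler_wpM2l // psq_dominates.
have eg i j : `|c i j * ev (E i j) x y| <= g i j.
  by have [N0 HN] := psq_ev (E i j); rewrite -(HN N0).
set s := sqsum (fun i j => c i j * ev (E i j) x y).
have key N : `|rpeval (recombine c E) x y - s N| <= limn (sqsum g) - sqsum g N.
  have h1 : (fun n => `|sqsum (fun a b => recombine c E a b * x ^+ a * y ^+ b) n - s N|) @ \oo
      --> `|rpeval (recombine c E) x y - s N|.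
    by apply: cvg_norm; apply: cvgB; [exact: (rpeval_cvg r0 recombine_conv)|exact: cvg_cst].
  rewrite -(cvg_lim _ h1) //; apply: limr_le; first exact: cvgP h1.
  have [N0 HN0] : exists N0, forall i j n, (i < N)%N -> (j < N)%N -> (N0 <= n)%N ->
      psq (E i j) x y n = ev (E i j) x y.
    pose N1 i j := projT1 (cid (psq_ev (E i j))).
    exists (\max_(i < N) \max_(j < N) N1 i j) => i j n iN jN le_n.
    apply: (projT2 (cid (psq_ev (E i j)))).
    apply: leq_trans le_n.
    apply: leq_trans (leq_bigmax (Ordinal iN)).
    exact: (leq_bigmax (F := fun j : 'I_N => N1 i j) (Ordinal jN)).
  exists (maxn N N0) => // n /=; rewrite geq_max => /andP[Nn N0n].
  have -> : s N = sqsum (fun i j => c i j * psq (E i j) x y n) N.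
    by apply: eq_bigr => i _; apply: eq_bigr => j _; rewrite HN0.
  rewrite recombine_psum.
  apply: le_trans (sqsum_dist (fg n) (_ : N <= 2 * n)%N) _; first by lia.
  rewrite lerD2r; apply: nondecreasing_cvgn_le; first exact: sqsum_homo.
  exact: (sqsum_ge0_cvg g0 cB).
apply/eqP; rewrite -subr_eq0 -normr_eq0; apply/eqP.
have h1 : (fun N => `|rpeval (recombine c E) x y - s N|) @ \oo -->
    `|rpeval (recombine c E) x y - limn s|.
  by apply: cvg_norm; apply: cvgB; [exact: cvg_cst|exact: (sqsum_cvg eg cB)].
apply: (cvg_unique _ h1) => //.
apply: (@squeeze_cvgr _ _ _ _ (fun=> 0) (fun N => limn (sqsum g) - sqsum g N)).
- by apply: nearW => N; rewrite normr_ge0 key.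
- exact: cvg_cst.
rewrite -[X in _ --> X](subrr (limn (sqsum g))).
by apply: cvgB; [exact: cvg_cst|exact: (sqsum_ge0_cvg g0 cB)].
Qed.

End Recombine.

End Rearrangement.

Lemma poly_low_bound (R : realDomainType) m (g : {poly R}) :
  (forall a, (a < m)%N -> g`_a = 0) ->
  exists C, 0 < C /\ forall x, `|x| <= 1 -> `|g.[x]| <= C * `|x| ^+ m.
Proof.
move=> g0; exists (1 + \sum_(a < size g) `|g`_a|); split.
  by rewrite ltr_wpDr // sumr_ge0.
move=> x x1; rewrite horner_coef mulrDl mul1r (le_trans (ler_norm_sum _ _ _)) //.
apply: ler_wpDl; first exact: exprn_ge0.
rewrite mulr_suml; apply: ler_sum => a _; rewrite normrM normrX.
have [am|ma] := ltnP a m; first by rewrite g0 // normr0 !mul0r.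
by rewrite ler_wpM2l // ler_wiXn2l.
Qed.

(** * The substitution [y -> x^n y - q(x)] in a convergent series *)

Section Composition.
Variable R : realType.
Implicit Types (c h : nat -> nat -> R) (q : {poly R}) (n : nat).

Definition blowup n q : {poly {poly R}} := ('X^n)%:P * 'X - q%:P.

Definition monom_blowup n q (i j : nat) : {poly {poly R}} := ('X^i)%:P * blowup n q ^+ j.

Definition trunc D c : {poly {poly R}} :=
  \sum_(i < D) \sum_(j < D) ((c i j)%:P * 'X^i)%:P * 'X^j.

Lemma ev_trunc D c x y : ev (trunc D c) x y = sqsum (fun i j => c i j * x ^+ i * y ^+ j) D.
Proof.
rewrite /ev /trunc /sqsum !horner_sum; apply: eq_bigr => i _.
rewrite !horner_sum; apply: eq_bigr => j _.
by rewrite hornerM hornerC hornerXn !hornerM hornerC hornerXn horner_exp hornerC.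
Qed.

Lemma ev_comp (P : {poly {poly R}}) (T : {poly {poly R}}) x y :
  ev (P \Po T) x y = ev P x (ev T x y).
Proof.
rewrite /ev horner_comp (horner_coef P T.[y%:P]) (horner_coef P _%:P) !horner_sum.
by apply: eq_bigr => i _; rewrite !hornerM !horner_exp hornerC.
Qed.

Lemma ev_blowup n q x y : ev (blowup n q) x y = x ^+ n * y - q.[x].
Proof. by rewrite /ev /blowup hornerD hornerN hornerM !hornerC hornerX hornerD hornerN hornerM hornerXn hornerC. Qed.

Lemma ev_monom_blowup n q i j x y :
  ev (monom_blowup n q i j) x y = x ^+ i * (x ^+ n * y - q.[x]) ^+ j.
Proof.
by rewrite -ev_blowup /ev /monom_blowup hornerM hornerC horner_exp hornerM hornerXn horner_exp.
Qed.

Lemma coef_trunc_blowup D c n q a b :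
  (trunc D c \Po blowup n q)`_b`_a = sqsum (fun i j => c i j * (monom_blowup n q i j)`_b`_a) D.
Proof.
rewrite /trunc rmorph_sum !coef_sum; apply: eq_bigr => i _.
rewrite rmorph_sum !coef_sum; apply: eq_bigr => j _.
rewrite rmorphM /= comp_polyC comp_Xn_poly coefCM -mulrA coefCM.
by rewrite /monom_blowup coefCM.
Qed.

Lemma low_order_monom_blowup n q i j : q`_0 = 0 -> low_order (i + j) (monom_blowup n q i j).
Proof.
move=> q0; apply: low_order_mul.
  move=> a b ab; rewrite coefC; case: eqP => [b0|]; last by rewrite coef0.
  by rewrite coefXn; case: eqP => //; lia.
have := @low_order_exp _ 1 (blowup n q) j; rewrite mul1n; apply => a b; rewrite ltnS leqn0 addn_eq0 => /andP[/eqP -> /eqP ->].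
by rewrite coefB coefCM coefX coefC mulr0 sub0r coefN q0 oppr0.
Qed.

Lemma coef_normXn i a : `|('X^i : {poly R})`_a| = ('X^i : {poly R})`_a.
Proof. by rewrite coefXn normr_nat. Qed.

(** The minus sign cancels the one in [blowup]: the majorant is [x^i (x^n y + |q|(x))^j], with [|q|]
    taken coefficientwise. *)
Lemma dominates_monom_blowup n q i j :
  dominates (monom_blowup n q i j) (monom_blowup n (- map_poly Num.norm q) i j).
Proof.
apply: dominates_mul.
  move=> a b; rewrite coefC; case: eqP; last by rewrite coef0 normr0.
  by rewrite coef_normXn.
apply: dominates_exp => a b; rewrite !coefB !coefCM !coefX !coefC.
case: b => [|[|b]] /=; rewrite ?mulr0 ?mulr1 ?coef0.
- by rewrite coefN !sub0r opprK normrN coef_map_id0 ?normr0.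
- by rewrite !subr0 coef_normXn.
- by rewrite subr0 normr0.
Qed.

Lemma compose_conv c n q r0 B : 0 < r0 -> rconv c r0 B -> q`_0 = 0 ->
  exists r, [/\ 0 < r, rconv (recombine c (monom_blowup n q)) r B &
    forall x y, `|x| <= r -> `|y| <= r ->
     rpeval c x (x ^+ n * y - q.[x]) = rpeval (recombine c (monom_blowup n q)) x y].
Proof.
move=> r00 cB q0.
have [C [C0 HC]] : exists C, 0 < C /\ forall x, `|x| <= 1 ->
    `|(map_poly Num.norm q).[x]| <= C * `|x| ^+ 1.
  apply: poly_low_bound => -[|//] _.
  by rewrite coef_map_id0 ?normr0 // q0 normr0.
(* With this [r], [r^n r + |q|(r) <= (1 + C) r <= r0], so the majorants at [(r, r)] are bounded by
   the terms of the original series at [r0]. *)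
pose r := Num.min 1 (r0 / (1 + C)).
have C1 : 0 < 1 + C by lra.
have r_gt0 : 0 < r by rewrite /r lt_min ltr01 divr_gt0.
have r1 : r <= 1 by rewrite /r ge_min lexx.
have rC : (1 + C) * r <= r0 by rewrite mulrC -ler_pdivlMr // /r ge_min lexx orbT.
have rr0 : r <= r0 by apply: le_trans rC; rewrite ler_peMl ?ltW //; lra.
have sB : forall N, sqsum (fun i j => `|c i j| *
    ev (monom_blowup n (- map_poly Num.norm q) i j) r r) N <= B.
  move=> N; apply: le_trans (cB N); apply: ler_sqsum => i j; rewrite ler_wpM2l //.
  have rn := ltW r_gt0.
  rewrite ev_monom_blowup hornerN opprK exprD ler_pM ?exprn_ge0 //; last first.
  - rewrite lerXn2r ?nnegrE ?(ltW r00) //.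
      rewrite addr_ge0 ?mulr_ge0 ?exprn_ge0 //.
      by rewrite horner_coef sumr_ge0 // => a _; rewrite mulr_ge0 ?exprn_ge0 // coef_map_id0 ?normr0.
    apply: le_trans rC; rewrite mulrDl lerD //.
      by rewrite ler_wpM2r // exprn_ile1.
    by have := HC r; rewrite (ger0_norm rn) expr1 => /(_ r1); apply: le_trans (ler_norm _).
  - by rewrite lerXn2r ?nnegrE // ltW.
  rewrite addr_ge0 ?mulr_ge0 ?exprn_ge0 //.
  by rewrite horner_coef sumr_ge0 // => a _; rewrite mulr_ge0 ?exprn_ge0 // coef_map_id0 ?normr0.
have lo i j : low_order (i + j) (monom_blowup n q i j) by exact: low_order_monom_blowup.
exists r; split=> //.
  exact: (recombine_conv (ltW r_gt0) (dominates_monom_blowup n q)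
    lo sB).
move=> x y xr yr.
rewrite (recombine_ev (ltW r_gt0) (dominates_monom_blowup n q)
    lo sB xr yr).
congr (limn _); apply/funext => N; apply: eq_sqsum => i j.
by rewrite ev_monom_blowup mulrA.
Qed.

Lemma sqsum_shift (f : nat -> nat -> R) k N : (forall i j, 0 <= f i j) ->
  sqsum (fun i j => f (i + k)%N j) N <= sqsum f (N + k).
Proof.
move=> f0.
have shift (F : nat -> R) : (forall i, 0 <= F i) ->
    \sum_(i < N) F (i + k)%N <= \sum_(i < N + k) F i.
  move=> F0; rewrite [in leRHS]addnC big_split_ord /=.
  by rewrite ler_wpDl ?sumr_ge0 //; apply: ler_sum => i _; rewrite addnC.
apply: (@le_trans _ _ (\sum_(i < N) \sum_(j < N + k) f (i + k)%N j)); last first.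
  by apply: (shift (fun i => \sum_(j < N + k) f i j)) => i; rewrite sumr_ge0.
apply: ler_sum => i _; rewrite big_split_ord /=.
by rewrite ler_wpDr ?sumr_ge0.
Qed.

(** The series [h] is the recombination of its shift [G] along the monomials [x^(i+k) y^j], so
    [recombine_ev] also covers division by [x^k]. *)
Lemma xfactor_conv h k r B : 0 < r -> rconv h r B ->
  (forall a b, (a < k)%N -> h a b = 0) ->
  exists G B', rconv G r B' /\ forall x y, `|x| <= r -> `|y| <= r ->
    rpeval h x y = x ^+ k * rpeval G x y.
Proof.
move=> r0 hB h0; have rn := ltW r0.
pose G a b := h (a + k)%N b.
pose E (i j : nat) : {poly {poly R}} := ('X^(i + k))%:P * 'X^j.
have coefE i j a b : (E i j)`_b`_a = ((b == j) && (a == i + k)%N)%:R.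
  rewrite /E coefCM coefXn; case: eqP => _ /=; last by rewrite mulr0 coef0.
  by rewrite mulr1 coefXn.
have evE i j x y : ev (E i j) x y = x ^+ k * (x ^+ i * y ^+ j).
  by rewrite /ev /E hornerM hornerC hornerXn hornerM hornerXn horner_exp hornerC exprD mulrA [x ^+ k * _]mulrC.
have dE i j : dominates (E i j) (E i j) by move=> a b; rewrite coefE normr_nat.
have lE i j : low_order (i + j) (E i j).
  by move=> a b ab; rewrite coefE; case: eqP => //= bj; case: eqP => //; lia.
have GB N : sqsum (fun i j => `|G i j| * ev (E i j) r r) N <= B.
  apply: le_trans (hB (N + k)%N).
  apply: le_trans (@sqsum_shift (fun i j => `|h i j| * r ^+ (i + j)) k N _); last first.
    by move=> i j; rewrite mulr_ge0 ?exprn_ge0.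
  by apply: ler_sqsum => i j; rewrite evE /G addnAC !exprD [r ^+ k * _]mulrC.
have GB' : rconv G r (r ^- k * B).
  move=> N; rewrite -(ler_pM2l (exprn_gt0 k r0)) mulrA divff ?expf_neq0 ?gt_eqF // mul1r.
  apply: le_trans (GB N); rewrite -sqsumZ; apply: ler_sqsum => i j.
  by rewrite evE exprD mulrCA.
exists G, (r ^- k * B); split=> //.
move=> x y xr yr.
have -> : h = recombine G E.
  apply/funext => a; apply/funext => b; rewrite /recombine /sqsum.
  have [ak|ka] := ltnP a k.
    rewrite h0 // big1 // => i _; rewrite big1 // => j _; rewrite coefE andbC.
    by case: eqP => [|_]; [lia|rewrite mulr0].
  have ai : (a - k < (a + b).+1)%N by lia.
  have bi : (b < (a + b).+1)%N by lia.
  rewrite (bigD1 (Ordinal ai)) //= (bigD1 (Ordinal bi)) //= coefE eqxx subnK // eqxx mulr1.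
  rewrite !big1 ?addr0 /G ?subnK //.
    move=> i /eqP ni; rewrite big1 // => j _; rewrite coefE andbC; case: eqP => [ae|_].
      by case: ni; apply: val_inj => /=; lia.
    by rewrite mulr0.
  move=> j /eqP nj; rewrite coefE; case: eqP => [be|_]; last by rewrite mulr0.
  by case: nj; apply: val_inj.
rewrite (recombine_ev rn dE lE GB xr yr) /rpeval.
apply/cvg_lim => //.
set s := sqsum (fun i j => G i j * x ^+ i * y ^+ j).
have key : (fun N => x ^+ k * s N) @ \oo --> x ^+ k * limn s.
  by apply: cvgMl_tmp; exact: (rpeval_cvg rn GB' xr yr).
apply: cvg_trans key; apply: near_eq_cvg; apply: nearW => N.
by rewrite -sqsumZ; apply: eq_sqsum => i j; rewrite evE [RHS]mulrCA !mulrA.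
Qed.

End Composition.

(** * Pointwise bounds near a branch *)

(** Estimates stable under a smaller radius and a larger constant hold for all branches at once,
    with the least radius and the sum of the constants. *)
Lemma uniform_constants (R : realType) (I : finType) (P : I -> R -> R -> Prop) :
  (forall i d d' K K', 0 < d' -> d' <= d -> 0 < K -> K <= K' -> P i d K -> P i d' K') ->
  (forall i, exists d K, [/\ 0 < d, 0 < K & P i d K]) ->
  exists d K, [/\ 0 < d, 0 < K & forall i, P i d K].
Proof.
move=> mono H.
have /choice[f fP] : forall i, exists dK : R * R, [/\ 0 < dK.1, 0 < dK.2 & P i dK.1 dK.2].
  by move=> i; have [d [K ?]] := H i; exists (d, K).
exists (\big[Num.min/1]_i (f i).1), (1 + \sum_i (f i).2).
have d0 : 0 < \big[Num.min/1]_i (f i).1.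
  apply: (big_ind (fun z : R => 0 < z)) => // [x y x0 y0|i _]; first by rewrite lt_min x0.
  by have [] := fP i.
split=> //.
  rewrite ltr_wpDr // sumr_ge0 // => i _; have [_ ? _] := fP i; exact: ltW.
move=> i; have [fd fK Pi] := fP i; apply: mono Pi => //; first exact: bigmin_le_cond.
rewrite (bigD1 i) //= addrCA lerDl addr_ge0 // sumr_ge0 // => l _.
by have [_ ? _] := fP l; exact: ltW.
Qed.

Lemma poly_low_lower (R : realFieldType) o (g : {poly R}) :
  (forall a, (a < o)%N -> g`_a = 0) -> g`_o != 0 ->
  exists d c, [/\ 0 < d, 0 < c & forall x, `|x| <= d -> c * `|x| ^+ o <= `|g.[x]|].
Proof.
move=> g0 go; pose g' := drop_poly o g - (g`_o)%:P.
have [C [C0 HC]] : exists C, 0 < C /\ forall x, `|x| <= 1 -> `|g'.[x]| <= C * `|x| ^+ 1.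
  apply: poly_low_bound => -[|//] _.
  by rewrite coefB coefC coef_drop_poly subrr.
have n0 : 0 < `|g`_o| by rewrite normr_gt0.
exists (Num.min 1 (`|g`_o| / 2 / C)), (`|g`_o| / 2); split.
- by rewrite lt_min ltr01 !divr_gt0.
- by rewrite divr_gt0.
move=> x; rewrite le_min => /andP[x1 xC].
rewrite [in leRHS](drop_poly_low0 g0) hornerM hornerXn normrM normrX mulrC ler_wpM2l ?exprn_ge0 //.
have -> : (drop_poly o g).[x] = g`_o + g'.[x] by rewrite hornerD hornerN hornerC addrC subrK.
have := HC x x1; rewrite expr1 => h.
have h2 : C * `|x| <= `|g`_o| / 2 by rewrite mulrC -ler_pdivlMr.
have := lerB_normD g`_o g'.[x]; lra.
Qed.

Section Branches.
Variables (R : realType) (M : nat) (L : 'I_M -> nat) (q : 'I_M -> {poly R}).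

Lemma coef_ordp (g : {poly R}) : g != 0 -> g`_(ordp g) != 0.
Proof.
move=> g0; apply: (nth_find 0 (a := fun a => a != 0)); apply/(has_nthP 0).
exists (size g).-1; first by rewrite prednK // size_poly_gt0.
by rewrite -lead_coefE lead_coef_eq0.
Qed.

Lemma leq_ordp (g : {poly R}) m : g != 0 ->
  (m <= ordp g)%N <-> forall a, (a < m)%N -> g`_a = 0.
Proof.
move=> g0; split=> [le_m a am|H].
  by have := before_find 0 (leq_trans am le_m) => /negbFE /eqP.
by rewrite leqNgt; apply/negP => /H h; have := coef_ordp g0; rewrite h eqxx.
Qed.

(** This is the hypothesis [OP] for [Oij]; the case [q j = q i] agrees with it because Ord(0) is
    infinite. *)
Lemma OijP i j m : (m <= Oij L q i j)%N <->
  [/\ (m <= 2 * L j)%N, (m <= 2 * L i)%N & forall a, (a < m)%N -> (q j)`_a = (q i)`_a].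
Proof.
rewrite /Oij; case: eqP => [/eqP|/eqP nz].
  rewrite subr_eq0 => /eqP ->; rewrite leq_min; split=> [/andP[]|[-> ->]] //.
rewrite !leq_min; split=> [/and3P[/(leq_ordp _ nz) H ? ?]|[h1 h2 H]].
  by split=> // a /H; rewrite coefB => /eqP; rewrite subr_eq0 => /eqP.
by rewrite h1 h2 !andbT; apply/(leq_ordp _ nz) => a /H; rewrite coefB => ->; rewrite subrr.
Qed.

Definition Pfactor j (x y : R) : R[i] := ((y + (q j).[x]) +i* x ^+ (2 * L j))%C.

Lemma cmodE (z : R[i]) : cmod z = ComplexField.Normc.normc z.
Proof. by case: z. Qed.

Lemma cmod_ge0 (z : R[i]) : 0 <= cmod z.
Proof. exact: sqrtr_ge0. Qed.

Lemma Re_le_cmod (z : R[i]) : `|complex.Re z| <= cmod z.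
Proof. by rewrite -sqrtr_sqr ler_sqrt ?addr_ge0 ?sqr_ge0 // lerDl sqr_ge0. Qed.

Lemma Im_le_cmod (z : R[i]) : `|complex.Im z| <= cmod z.
Proof. by rewrite -sqrtr_sqr ler_sqrt ?addr_ge0 ?sqr_ge0 // lerDr sqr_ge0. Qed.

Lemma cmod_le (z : R[i]) : cmod z <= `|complex.Re z| + `|complex.Im z|.
Proof.
rewrite -(ger0_norm (addr_ge0 (normr_ge0 (complex.Re z)) (normr_ge0 (complex.Im z)))).
rewrite -sqrtr_sqr ler_sqrt ?sqr_ge0 // sqrrD !real_normK ?num_real //.
by rewrite addrAC lerDl mulrn_wge0 // mulr_ge0.
Qed.

Lemma cmod_prod (I : Type) (s : seq I) (F : I -> R[i]) :
  cmod (\prod_(i <- s) F i) = \prod_(i <- s) cmod (F i).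
Proof.
elim: s => [|i s IH]; first by rewrite !big_nil cmodE ComplexField.Normc.normc1.
by rewrite !big_cons cmodE ComplexField.Normc.normcM -!cmodE IH.
Qed.

Lemma cmod_div (z w : R[i]) : cmod (z / w) = cmod z / cmod w.
Proof. by rewrite cmodE ComplexField.Normc.normcM ComplexField.Normc.normcV -!cmodE. Qed.

Lemma cmod_Pval x y : cmod (Pval L q x y) = \prod_(i < M) cmod (Pfactor i x y).
Proof. exact: cmod_prod. Qed.

(** On this curve [y + q_i] is [x^(2 L_j) t] plus [q_i - q_j], and these two terms and [x^(2 L_i)]
    each have order at least [O_ij]. *)
Lemma Pfactor_upper i j : exists C, 0 < C /\ forall x t, `|x| <= 1 -> `|t| <= 1 ->
  cmod (Pfactor i x (x ^+ (2 * L j) * t - (q j).[x])) <= C * `|x| ^+ Oij L q i j.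
Proof.
have [oj oi oq] := (OijP i j _).1 (leqnn (Oij L q i j)).
have [C [C0 HC]] : exists C, 0 < C /\ forall x, `|x| <= 1 ->
    `|(q i - q j).[x]| <= C * `|x| ^+ Oij L q i j.
  by apply: poly_low_bound => a /oq; rewrite coefB => ->; rewrite subrr.
exists (2 + C); split=> [|x t x1 t1]; first by lra.
apply: le_trans (cmod_le _) _; rewrite /=.
have h1 : `|x| ^+ (2 * L j) <= `|x| ^+ Oij L q i j by rewrite ler_wiXn2l.
have h2 : `|x| ^+ (2 * L i) <= `|x| ^+ Oij L q i j by rewrite ler_wiXn2l.
have h3 : `|x ^+ (2 * L j) * t| <= `|x| ^+ Oij L q i j.
  by rewrite normrM normrX; apply: le_trans h1; rewrite ler_piMr ?exprn_ge0.
have h4 : `|x ^+ (2 * L j) * t - (q j).[x] + (q i).[x]| <=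
    `|x ^+ (2 * L j) * t| + `|(q i - q j).[x]|.
  by rewrite -addrA (addrC (- _)) hornerD hornerN ler_normD.
have := HC x x1; rewrite normrX; lra.
Qed.

(** If [O_ij] is [2 L_j] or [2 L_i], an imaginary part gives the bound. Otherwise it is the order of
    [q_j - q_i], which is at most the sum of the two factors in modulus, hence at most twice the
    larger one; this explains [c / 2]. *)
Lemma Pfactor_lower i j : exists d c, [/\ 0 < d, 0 < c & forall x y, `|x| <= d ->
  cmod (Pfactor j x y) <= cmod (Pfactor i x y) ->
  c * `|x| ^+ Oij L q i j <= cmod (Pfactor i x y)].
Proof.
have [oj oi oq] := (OijP i j _).1 (leqnn (Oij L q i j)).
have cf l x y : `|x| ^+ (2 * L l) <= cmod (Pfactor l x y).
  by have := Im_le_cmod (Pfactor l x y); rewrite normrX.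
have [oE|oE] := eqVneq (Oij L q i j) (2 * L j)%N.
  exists 1, 1; split=> // x y x1 le_ji; rewrite mul1r oE.
  exact: le_trans (cf _ _ _) le_ji.
have [oE'|oE'] := eqVneq (Oij L q i j) (2 * L i)%N.
  by exists 1, 1; split=> // x y x1 le_ji; rewrite mul1r oE'.
have [d [c [d0 c0 H]]] : exists d c, [/\ 0 < d, 0 < c & forall x, `|x| <= d ->
    c * `|x| ^+ Oij L q i j <= `|(q j - q i).[x]|].
  apply: poly_low_lower => [a /oq|]; first by rewrite coefB => ->; rewrite subrr.
  apply/eqP => q0; suff : (Oij L q i j < Oij L q i j)%N by rewrite ltnn.
  apply/OijP; split.
  - by rewrite ltn_neqAle oE oj.
  - by rewrite ltn_neqAle oE' oi.
  move=> a; rewrite ltnS leq_eqVlt => /predU1P[->|/oq//].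
  by move/eqP: q0; rewrite coefB subr_eq0 => /eqP.
exists d, (c / 2); split=> // [|x y xd le_ji]; first by rewrite divr_gt0.
have h1 : `|y + (q j).[x]| <= cmod (Pfactor j x y) := Re_le_cmod (Pfactor j x y).
have h2 : `|y + (q i).[x]| <= cmod (Pfactor i x y) := Re_le_cmod (Pfactor i x y).
have h3 : `|(q j - q i).[x]| <= `|y + (q j).[x]| + `|y + (q i).[x]|.
  rewrite hornerD hornerN.
  have -> : (q j).[x] - (q i).[x] = (y + (q j).[x]) - (y + (q i).[x]) by lra.
  by rewrite ler_normB.
have := H x xd; lra.
Qed.

End Branches.

(** Only finitely many pairs [(s, m)] occur, so the largest ratio [s / (m + 1)] over the good ones
    is still below [1/p]. The starting value [(2 p)^-1] keeps [l] positive. *)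
Lemma good_exponent (R : realType) (p : R) (B : nat) : 1 <= p ->
  exists l, [/\ 0 < l, l * p < 1 & forall s m, (s <= B)%N -> (m <= B)%N ->
    good p m s -> s%:R <= m.+1%:R * l].
Proof.
move=> p1; have p0 : 0 < p := lt_le_trans ltr01 p1.
pose F (z : 'I_B.+1 * 'I_B.+1) : R := z.1%:R / z.2.+1%:R.
exists (\big[Num.max/(2 * p)^-1]_(z : 'I_B.+1 * 'I_B.+1 | good p z.2 z.1) F z); split.
- by apply: lt_le_trans (bigmax_ge_id _ _ _ _); rewrite invr_gt0 mulr_gt0.
- rewrite -ltr_pdivlMr // div1r; apply: bigmax_lt.
    by rewrite ltf_pV2 ?posrE ?mulr_gt0 //; lra.
  move=> [s m] /= g; rewrite /F ltr_pdivrMr ?ltr0Sn // mulrC ltr_pdivlMr //.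
move=> s m sB mB g; rewrite mulrC -ler_pdivrMr ?ltr0Sn //.
have sB' : (s < B.+1)%N by []; have mB' : (m < B.+1)%N by [].
exact: (le_bigmax_cond (P := fun z : 'I_B.+1 * 'I_B.+1 => good p z.2 z.1) _ F
  (g : good p (Ordinal sB', Ordinal mB').2 (Ordinal sB', Ordinal mB').1)).
Qed.

Lemma scale_bracket (R : realType) (xi u : R) n : 0 <= u ->
  n%:R * xi <= u \/ exists2 m, (m < n)%N & m%:R * xi <= u <= m.+1%:R * xi.
Proof.
move=> u0; elim: n => [|n [IH|[m mn H]]]; first by left; rewrite mul0r.
  have [le_u|lt_u] := leP (n.+1%:R * xi) u; first by left.
  by right; exists n => //; rewrite IH ltW.
by right; exists m => //; apply: leq_trans mn _.
Qed.

(** Each [W i] may be bounded below by [X^(o i)] or by [U]; [P] collects the indices for which the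
    first is chosen. After taking logarithms the claim is linear in [u] on each interval
    [[m xi, (m + 1) xi]], and the hypothesis at [m] and [m + 1] is the claim at its two ends. *)
Lemma monomial_bound (R : realType) (M n : nat) (o : 'I_M -> nat) (l : R) (a b : nat)
    (X U : R) (W c : 'I_M -> R) :
  (forall i, (o i <= n)%N) -> 0 < l ->
  (forall m, (m <= n)%N ->
    (\sum_i minn (o i) m)%:R <= a%:R + m%:R * b%:R + m.+1%:R * l) ->
  0 < X < 1 -> 0 < U < 1 -> (forall i, 0 < c i) ->
  (forall i, c i * X ^+ o i <= W i) -> (forall i, c i * U <= W i) ->
  (\prod_i c i) * (X ^+ a * U ^+ b * (X * U) `^ l) <= \prod_i W i.
Proof.
move=> on l0 Hs /andP[X0 X1] /andP[U0 U1] c0 cX cU.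
pose xi := - ln X; pose u := - ln U.
have xi0 : 0 <= xi by rewrite oppr_ge0 ln_le0 // ltW.
have u0 : 0 <= u by rewrite oppr_ge0 ln_le0 // ltW.
have powX (Y : R) k : 0 < Y -> Y ^+ k = expR (k%:R * ln Y).
  by move=> Y0; rewrite -powR_mulrn ?ltW // /powR gt_eqF.
have prodge (P : pred 'I_M) : \prod_i c i * (X ^+ (\sum_(i | P i) o i) * U ^+ #|[predC P]|)
    <= \prod_i W i.
  rewrite -[X in X * _ <= _](mulr1) (bigID P) /= mulr1 -prodrXr -prodr_const.
  rewrite mulrACA -!big_split /= [leRHS](bigID P) /=.
  apply: ler_pM.
  - by apply: prodr_ge0 => i _; rewrite mulr_ge0 ?exprn_ge0 // ltW.
  - by apply: prodr_ge0 => i _; rewrite mulr_ge0 // ltW.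
  - by apply: ler_prod => i _; rewrite cX mulr_ge0 ?exprn_ge0 // ltW.
  by apply: ler_prod => i _; rewrite cU mulr_ge0 // ltW.
suff [P HP] : exists P : pred 'I_M, (\sum_(i | P i) o i)%:R * xi + #|[predC P]|%:R * u <=
    (a%:R + l) * xi + (b%:R + l) * u.
  apply: le_trans (prodge P); apply: ler_wpM2l.
    by apply: prodr_ge0 => i _; rewrite ltW.
  rewrite /powR gt_eqF ?mulr_gt0 // lnM ?posrE // !powX // -!expRD ler_expR.
  move: HP; rewrite /xi /u; set A := ln X; set B := ln U.
  set s := (\sum_(i | P i) o i)%:R; set N := #|_|%:R.
  rewrite !mulrN !mulrDl !mulrDr; lra.
have [le_u|[m mn /andP[le_u u_le]]] := scale_bracket xi n u0.
  (* Here [U <= X^n]: no factor needs [U], and lowering [U] further only helps. *)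
  exists predT.
  have -> : #|[predC predT : pred 'I_M]| = 0%N by apply: eq_card0 => i; rewrite !inE.
  have := Hs n (leqnn n).
  have -> : (\sum_i minn (o i) n = \sum_i o i)%N.
    by apply: eq_bigr => i _; apply/minn_idPl.
  move=> h; rewrite mul0r addr0.
  have h2 := ler_wpM2r xi0 h.
  have h3 : (b%:R + l) * (n%:R * xi) <= (b%:R + l) * u.
    by rewrite ler_wpM2l // addr_ge0 ?ler0n // ltW.
  apply: le_trans h2 _; rewrite -natr1; move: h3.
  rewrite !mulrDl !mul1r ![b%:R * (n%:R * xi)]mulrA ![b%:R * n%:R]mulrC [l * (n%:R * xi)]mulrA [l * n%:R]mulrC; lra.
exists [pred i | (o i <= m)%N].
have key k : (k <= 1)%N -> (\sum_i minn (o i) (m + k) =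
    \sum_(i | (o i <= m)%N) o i + (m + k) * #|[predC [pred i | (o i <= m)%N]]|)%N.
  move=> k1; rewrite (bigID (fun i => (o i <= m)%N)) /=; congr addn.
    by apply: eq_bigr => i oi; apply/minn_idPl; lia.
  rewrite -sum1_card big_distrr /=; apply: eq_big => [i|i]; rewrite ?inE //.
  by move=> oi; rewrite muln1; apply/minn_idPr; lia.
have := Hs m (ltnW mn); have := Hs m.+1 mn.
have := key 0%N isT; have := key 1%N isT; rewrite addn0 addn1 => -> ->.
set s := (\sum_(i | _) o i)%N; set N := #|_|; rewrite /= -/s.
rewrite !natrD !natrM -![m.+1%:R]natr1 -![m.+2%:R]natr1 -![m.+1%:R]natr1.
move=> h2 h1.
have h1' := ler_wpM2r xi0 h1; have h2' := ler_wpM2r xi0 h2.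
rewrite -natr1 in u_le.
(* The sign of the slope [N - (b + l)] decides which end of the interval is the worst case. *)
have [B0|B0] := leP N%:R (b%:R + l).
  have := ler_wpM2l (_ : 0 <= b%:R + l - N%:R) le_u; rewrite subr_ge0 => /(_ B0).
  move: h1'; nra.
have := ler_wpM2l (_ : 0 <= N%:R - (b%:R + l)) u_le; rewrite subr_ge0 => /(_ (ltW B0)).
move: h2'; nra.
Qed.

Lemma exprD_le (R : realType) (s t : R) D : 0 <= s -> 0 <= t ->
  (s + t) ^+ D <= 2 ^+ D * (s ^+ D + t ^+ D).
Proof.
move=> s0 t0; wlog st : s t s0 t0 / s <= t.
  move=> H; have [/H|/ltW/H] := leP s t; first exact.
  by rewrite addrC [t ^+ D + _]addrC; apply.
apply: le_trans (_ : (2 * t) ^+ D <= _).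
  by rewrite lerXn2r ?nnegrE //; lra.
by rewrite exprMn ler_wpM2l ?exprn_ge0 // lerDr exprn_ge0.
Qed.

Section BranchBound.
Variables (R : realType) (M : nat) (L : 'I_M -> nat) (q : 'I_M -> {poly R}).
Variables (p l : R) (c : nat -> nat -> R) (r B : R).
Let O := Oij L q.
Let S := (\sum_i 2 * L i)%N.
Let C := trunc S.+1 c.
Hypothesis l0 : 0 < l.
Hypothesis lP : forall s m, (s <= S)%N -> (m <= S)%N -> good p m s -> s%:R <= m.+1%:R * l.
Hypothesis r0 : 0 < r.
Hypothesis cB : rconv c r B.

Lemma scale_sum_le m j : (scale_sum O m j <= S)%N.
Proof.
apply: leq_sum => i _; apply: leq_trans (geq_minl _ _) _.
by have [] := (OijP L q i j _).1 (leqnn (O i j)).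
Qed.

Lemma branch_bound j : (q j)`_0 = 0 ->
  (forall m a b, (m <= 2 * L j)%N -> (branch q C j)`_b`_a != 0 ->
     good p m (scale_sum O m j - (a + m * b))) ->
  exists d K, [/\ 0 < d, 0 < K & forall x y, `|x| < d -> `|y| < d ->
    x != 0 -> y + (q j).[x] != 0 ->
    (forall i, cmod (Pfactor L q j x y) <= cmod (Pfactor L q i x y)) ->
    `|rpeval c x y| * (`|x| * `|y + (q j).[x]|) `^ l <= K * cmod (Pval L q x y)].
Proof.
move=> qj0 Hgood.
have Lj : (2 * L j <= S)%N by rewrite /S (bigD1 j) //= leq_addr.
have [d1 [K1 [d10 K10 HK1]]] : exists d K, [/\ 0 < d, 0 < K & forall i x y, `|x| <= d ->
    cmod (Pfactor L q j x y) <= cmod (Pfactor L q i x y) ->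
    `|x| ^+ O i j <= K * cmod (Pfactor L q i x y)].
  have [||d [K [d0 K0 H]]] := @uniform_constants R 'I_M (fun i d K => forall x y, `|x| <= d ->
    cmod (Pfactor L q j x y) <= cmod (Pfactor L q i x y) ->
    `|x| ^+ O i j <= K * cmod (Pfactor L q i x y)).
  - move=> i d d' K K' d'0 dd K0 KK H x y xd le_ji.
    apply: le_trans (H x y (le_trans xd dd) le_ji) _.
    by rewrite ler_wpM2r ?cmod_ge0.
  - move=> i; have [d [k [d0 k0 H]]] := Pfactor_lower L q i j.
    exists d, k^-1; split=> // [|x y xd le_ji]; first by rewrite invr_gt0.
    by rewrite mulrC ler_pdivlMr // mulrC; apply: H.
  - by exists d, K; split.
have [Cq [Cq0 HCq]] : exists C, 0 < C /\ forall x, `|x| <= 1 -> `|(q j).[x]| <= C * `|x| ^+ 1.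
  by apply: poly_low_bound => -[|//] _.
have [N HN] := psq_ev (branch q C j).
(* Adding 1 makes [k1] at most 1 as well as at most [1 / K1], so one constant serves for both lower
   bounds, by [|x|^(O i j)] and by [|u|]. *)
pose k1 := (K1 + 1)^-1; pose Kp := (k1 ^+ M)^-1.
have k10 : 0 < k1 by rewrite invr_gt0; lra.
have Kp0 : 0 < Kp by rewrite invr_gt0 exprn_gt0.
pose T := r ^- S.+1 * B.
have B0 : 0 <= B by have := cB 0%N; rewrite /sqsum big_ord0.
have T0 : 0 <= T by rewrite mulr_ge0 // invr_ge0 exprn_ge0 // ltW.
pose A := sqsum (fun a b => `|(branch q C j)`_b`_a|) N.
have A0 : 0 <= A by apply: sumr_ge0 => a _; apply: sumr_ge0.
pose Q2 := 2 ^+ S.+1 * (1 + Cq ^+ S.+1).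
have Q20 : 0 <= Q2 by rewrite mulr_ge0 ?addr_ge0 ?exprn_ge0 // ltW.
pose d := Num.min (Num.min d1 1) (Num.min r (Num.min 1 ((2 * (1 + Cq))^-1))).
exists d, (Kp * (A + T * (1 + Q2 + Q2)) + 1); split.
- by rewrite /d !lt_min d10 ltr01 r0 invr_gt0; apply: mulr_gt0; lra.
- have : 0 <= Kp * (A + T * (1 + Q2 + Q2)); last by lra.
  by apply: mulr_ge0; [exact: ltW|apply: addr_ge0 => //; apply: mulr_ge0 => //; lra].
move=> x y; rewrite /d !lt_min => /and3P[/andP[xd1 x1] xr /andP[_ xC]].
move=> /and3P[_ yr /andP[_ yC]] x0 u0 jmin.
pose u := y + (q j).[x].
have qx : `|(q j).[x]| <= Cq * `|x| by have := HCq x (ltW x1); rewrite expr1.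
have u1 : `|u| < 1.
  have := ler_normD y (q j).[x]; rewrite -/u => h.
  have h1 : `|x| * (2 * (1 + Cq)) < 1 by rewrite -ltr_pdivlMr ?div1r //; apply: mulr_gt0; lra.
  have h2 : `|y| * (2 * (1 + Cq)) < 1 by rewrite -ltr_pdivlMr ?div1r //; apply: mulr_gt0; lra.
  have h3 : `|y| * 1 <= `|y| * (1 + Cq) by rewrite ler_wpM2l //; lra.
  rewrite !mulrDr !mulr1 in h1 h2 h3 *.
  have := normr_ge0 x; have := normr_ge0 y; lra.
set P := cmod (Pval L q x y).
set e := (_ `^ l).
have e0 : 0 <= e := powR_ge0 _ _.
have mono a b : (forall m, (m <= 2 * L j)%N ->
    (scale_sum O m j)%:R <= a%:R + m%:R * b%:R + m.+1%:R * l) ->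
    `|x| ^+ a * `|u| ^+ b * e <= Kp * P.
  move=> Hs; rewrite [leRHS]mulrC ler_pdivlMr ?exprn_gt0 // [leLHS]mulrC /P cmod_Pval.
  have <- : \prod_(i < M) k1 = k1 ^+ M by rewrite prodr_const card_ord.
  apply: (@monomial_bound _ _ (2 * L j) (fun i => O i j)) => //.
  - by move=> i; have [] := (OijP L q i j _).1 (leqnn (O i j)).
  - by rewrite normr_gt0 x0.
  - by rewrite normr_gt0 u0.
  - move=> i; rewrite [leLHS]mulrC ler_pdivrMr; last by lra.
    apply: le_trans (HK1 i x y (ltW xd1) (jmin i)) _.
    by rewrite mulrC ler_wpM2l ?cmod_ge0 //; lra.
  - move=> i; apply: le_trans (jmin i); apply: le_trans (Re_le_cmod _).
    rewrite /= -/u ler_piMl // invf_le1; lra.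
(* The pure powers of exponent [S + 1] control the truncation error; their conditions hold since
   [scale_sum] is at most [S], and 0 at [m = 0]. *)
have mD0 : `|x| ^+ S.+1 * e <= Kp * P.
  rewrite -[X in X * e]mulr1 -[1](expr0 `|u|); apply: mono => m mL.
  rewrite mulr0 addr0 ler_wpDr ?mulr_ge0 ?ler0n ?(ltW l0) // ler_nat.
  by apply: leq_trans (scale_sum_le _ _) _.
have mD1 : `|u| ^+ S.+1 * e <= Kp * P.
  rewrite -[X in X * e]mul1r -[1](expr0 `|x|); apply: mono => -[|m] mL.
    by rewrite mul0r addr0 /scale_sum big1 ?ler_wpDr ?mulr_ge0 ?ler0n ?(ltW l0) // => i _; rewrite minn0.
  rewrite add0r ler_wpDr ?mulr_ge0 ?ler0n ?(ltW l0) // -natrM ler_nat.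
  by apply: leq_trans (scale_sum_le _ _) _; rewrite mulSn (leq_trans (leqnSn S)) ?leq_addr.
have evC : ev C x y = ev (branch q C j) x u.
  rewrite /branch ev_comp; congr (ev C x _).
  by rewrite /ev hornerD hornerN hornerX !hornerC hornerD hornerN !hornerC /u addrK.
have hA : `|ev C x y| * e <= A * (Kp * P).
  rewrite evC -(HN N) // /psq /A /sqsum mulr_suml.
  apply: le_trans (ler_wpM2r e0 (ler_norm_sum _ _ _)) _; rewrite mulr_suml.
  apply: ler_sum => a _.
  apply: le_trans (ler_wpM2r e0 (ler_norm_sum _ _ _)) _; rewrite !mulr_suml.
  apply: ler_sum => b _; rewrite !normrM !normrX -!mulrA.
  have [->|nz] := eqVneq ((branch q C j)`_b`_a) 0; first by rewrite normr0 !mul0r.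
  rewrite ler_wpM2l // mulrA; apply: mono => m mL.
  have := lP (_ : (scale_sum O m j - (a + m * b) <= S)%N) (leq_trans mL Lj) (Hgood m a b mL nz).
  move=> /(_ (leq_trans (leq_subr _ _) (scale_sum_le _ _))) h.
  rewrite -natrM -natrD -lerBlDl; apply: le_trans h.
  by rewrite lerBlDl -natrD ler_nat -leq_subLR.
have hT : `|rpeval c x y - ev C x y| <= T * (`|x| ^+ S.+1 + `|y| ^+ S.+1).
  by rewrite ev_trunc; apply: trunc_bound => //; rewrite ltW.
(* The truncation is made in [y] but the estimates are in [u = y + q_j(x)]. *)
have hy : `|y| ^+ S.+1 <= Q2 * (`|x| ^+ S.+1 + `|u| ^+ S.+1).
  apply: le_trans (_ : (`|u| + Cq * `|x|) ^+ S.+1 <= _).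
    rewrite lerXn2r ?nnegrE ?addr_ge0 ?mulr_ge0 ?(ltW Cq0) //.
    have -> : y = u - (q j).[x] by rewrite addrK.
    by rewrite (le_trans (ler_normB _ _)) // lerD2l.
  apply: le_trans (exprD_le _ _ _) _; rewrite ?mulr_ge0 ?(ltW Cq0) //.
  rewrite /Q2 -mulrA ler_wpM2l ?exprn_ge0 // exprMn mulrDl mul1r mulrDr.
  have := exprn_ge0 S.+1 (normr_ge0 x); have := exprn_ge0 S.+1 (normr_ge0 u).
  have := exprn_ge0 S.+1 (ltW Cq0) => h1 h2 h3.
  have := mulr_ge0 h1 h2; lra.
have hR : `|rpeval c x y| <= `|ev C x y| + T * (`|x| ^+ S.+1 + `|y| ^+ S.+1).
  have := ler_normD (rpeval c x y - ev C x y) (ev C x y); rewrite subrK => /le_trans; apply.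
  by rewrite addrC lerD2l.
apply: le_trans (ler_wpM2r e0 hR) _; rewrite mulrDl.
have hE : (`|x| ^+ S.+1 + `|y| ^+ S.+1) * e <= (1 + Q2 + Q2) * (Kp * P).
  have h1 : `|x| ^+ S.+1 + `|y| ^+ S.+1 <= (1 + Q2) * `|x| ^+ S.+1 + Q2 * `|u| ^+ S.+1.
    by move: hy; rewrite mulrDl mul1r mulrDr; lra.
  apply: le_trans (ler_wpM2r e0 h1) _; rewrite [leLHS]mulrDl [leRHS]mulrDl lerD //.
    by rewrite -[leLHS]mulrA ler_wpM2l ?addr_ge0.
  by rewrite -[leLHS]mulrA ler_wpM2l.
apply: le_trans (_ : (A + T * (1 + Q2 + Q2)) * (Kp * P) <= _).
  by rewrite [leRHS]mulrDl lerD // -[leLHS]mulrA -[leRHS]mulrA; exact: ler_wpM2l.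
rewrite mulrA [_ * Kp]mulrC [leRHS]mulrDl mul1r lerDl.
exact: cmod_ge0.
Qed.

End BranchBound.

(** * Integrability *)

Section DyadicMajorant.
Variables (R : realType) (theta : R).
Hypotheses (theta0 : 0 < theta) (theta1 : theta < 1).

(** On the shell [2^-(k+1) < |t| <= 2^-k] this already exceeds [|t|^-theta]. *)
Definition dyadic_term (k : nat) (t : R) : \bar R :=
  (((2 ^+ k.+1) `^ theta)%:E * (\1_(`[- (2 ^- k), 2 ^- k]%classic : set R) t)%:E)%E.

(* A majorant of [|t|^-theta] near 0, infinite at 0 itself. *)
Definition dyadic (t : R) : \bar R := (\sum_(0 <= k <oo) dyadic_term k t)%E.

Lemma dyadic_term_ge0 k t : (0 <= dyadic_term k t)%E.
Proof. by rewrite mule_ge0 // lee_fin ?powR_ge0 // indicE ler0n. Qed.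

Lemma dyadic_ge0 t : (0 <= dyadic t)%E.
Proof. by apply: nneseries_ge0 => k _ _; exact: dyadic_term_ge0. Qed.

Lemma measurable_dyadic_term k : measurable_fun setT (dyadic_term k).
Proof.
apply: emeasurable_funM; first exact: measurable_cst.
by apply/measurable_EFinP; apply: measurable_indic; exact: measurable_itv.
Qed.

Lemma measurable_dyadic : measurable_fun setT dyadic.
Proof.
apply: (@ge0_emeasurable_sum _ _ _ setT dyadic_term predT).
  by move=> k x _ _; exact: dyadic_term_ge0.
by move=> k _; exact: measurable_dyadic_term.
Qed.

Lemma dyadic_term_le k t : (dyadic_term k t <= dyadic t)%E.
Proof.
apply: le_trans (nneseries_lim_ge k.+1 _); last by move=> *; exact: dyadic_term_ge0.
rewrite big_nat_recr //=; apply: leeDr.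
by apply: sume_ge0 => i _; exact: dyadic_term_ge0.
Qed.

Lemma dyadic_lower t : 0 < `|t| < 1 -> (((`|t| `^ theta)^-1)%:E <= dyadic t)%E.
Proof.
move=> /andP[t0 t1].
have exk : exists k, 2 ^- k.+1 < `|t|.
  exists (Num.truncn `|t|^-1); rewrite invf_plt ?posrE ?exprn_gt0 //.
  apply: lt_le_trans (truncnS_gt _) _.
  by rewrite -natrX ler_nat ltnW // ltn_expl.
case: (ex_minnP exk) => k kt kmin.
have tk : `|t| <= 2 ^- k.
  case: k kt kmin => [|k] kt kmin; first by rewrite expr0 invr1 ltW.
  by rewrite leNgt; apply/negP => /kmin; rewrite ltnn.
apply: le_trans (dyadic_term_le k t).
rewrite /dyadic_term indicE mem_set /=; last first.
  by rewrite in_itv /= -ler_norml.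
rewrite mule1 lee_fin -powR_inv1 ?powR_ge0 // -powRrM mulrN1 powRN.
rewrite -powR_inv1 ?powR_ge0 // -powRrM mulrC powRrM powR_inv1 //.
rewrite ge0_ler_powR ?nnegrE ?invr_ge0 ?exprn_ge0 // ?ltW //.
by rewrite invf_plt ?posrE // ?exprn_gt0.
Qed.

(** The infinite value makes the majorization trivial where [x = 0] or [y + q_j(x) = 0], so no null
    sets have to be removed. *)
Lemma dyadic0 : dyadic 0 = +oo%E.
Proof.
apply/eqyP => A A0; have [n nA] : exists n : nat, A <= n%:R.
  by exists (Num.truncn A).+1; rewrite ltW // truncnS_gt.
apply: le_trans (nneseries_lim_ge n _); last by move=> *; exact: dyadic_term_ge0.
apply: (@le_trans _ _ (\sum_(0 <= i < n) (1 : R)%:E)%E).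
  by rewrite sumEFin lee_fin sumr_const_nat subn0.
apply: lee_sum => i _; rewrite /dyadic_term indicE mem_set /=; last first.
  by rewrite in_itv /= oppr_le0 invr_ge0 exprn_ge0.
have p1 : 1 `^ theta = 1 :> R by rewrite powR1.
rewrite mule1 lee_fin -[leLHS]p1 ge0_ler_powR ?nnegrE ?exprn_ge0 //.
  exact: ltW.
by rewrite exprn_ege1 //; lra.
Qed.

(** The [k]-th term integrates to [2 * 2^theta] times the [k]-th power of [2^theta / 2 < 1]. The
    bound is uniform in [s] because the inner integral over [y] is shifted by [g(x)]. *)
Lemma integral_dyadic_shift : exists Z : R, 0 <= Z /\ forall s : R,
  (\int[lebesgue_measure]_y dyadic (y + s) <= Z%:E)%E.
Proof.
pose a : R := 2 * 2 `^ theta; pose z : R := 2 `^ theta / 2.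
have z0 : 0 < z by rewrite divr_gt0 // powR_gt0.
have z1 : z < 1.
  have ln2 : 0 < ln 2 :> R by rewrite ln_gt0 //; lra.
  rewrite ltr_pdivrMr // mul1r /powR pnatr_eq0 /= -[ltRHS]lnK ?posrE // ltr_expR.
  by rewrite gtr_pMl.
have a0 : 0 <= a by rewrite mulr_ge0 // powR_ge0.
exists (a / (1 - z)); split=> [|s]; first by rewrite divr_ge0 // subr_ge0 ltW.
have mshift : measurable_fun setT (fun y : R => y + s).
  exact: measurable_funD.
rewrite integral_nneseries //; last by move=> *; exact: dyadic_term_ge0.
  apply: lime_le; first by apply: is_cvg_nneseries => k _ _; apply: integral_ge0 => y _; exact: dyadic_term_ge0.
  apply: nearW => n.
  apply: (@le_trans _ _ (series (geometric a z) n)%:E); last first.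
    by rewrite lee_fin geometric_le_lim // ger0_norm // ltW.
  rewrite /series /= -sumEFin; apply: lee_sum => k _.
  have -> : (\int[lebesgue_measure]_y dyadic_term k (y + s) = ((2 ^+ k.+1) `^ theta)%:E *
      \int[lebesgue_measure]_y (\1_(`[- (2 ^- k), 2 ^- k]%classic : set R) (y + s))%:E)%E.
    apply: ge0_integralZl_EFin => //.
    have mi : measurable_fun setT (\1_(`[- (2 ^- k), 2 ^- k]%classic : set R) : R -> R).
      by apply: measurable_indic; exact: measurable_itv.
    by apply/measurable_EFinP; exact: (measurableT_comp mi mshift).
  have -> : (\int[lebesgue_measure]_y (\1_(`[- (2 ^- k), 2 ^- k]%classic : set R) (y + s))%:E =
    \int[lebesgue_measure]_y (\1_(`[- (2 ^- k) - s, 2 ^- k - s]%classic : set R) y)%:E)%E.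
    apply: eq_integral => y _; congr (_%:E); rewrite !indicE; congr ((nat_of_bool _)%:R).
    by apply/idP/idP => /set_mem /=; rewrite in_itv /= => h; apply/mem_set; rewrite /= in_itv /=; lra.
  have e0 : 0 < (2 ^- k : R) by rewrite invr_gt0 exprn_gt0.
  have -> : (\int[lebesgue_measure]_y
      (\1_(`[- (2 ^- k) - s, 2 ^- k - s]%classic : set R) y)%:E = (2 * 2 ^- k)%:E)%E.
    rewrite integral_indic //= setIT; etransitivity; first exact: lebesgue_measure_itv.
    rewrite /= lte_fin ifT; last by lra.
    by rewrite -EFinB; congr EFin; lra.
  rewrite -EFinM lee_fin /geometric /= /a /z.
  have -> : (2 ^+ k.+1 : R) `^ theta = 2 `^ theta * (2 `^ theta) ^+ k.
    rewrite exprS powRM ?exprn_ge0 //; congr (_ * _).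
    by rewrite -powR_mulrn // -powRrM mulrC powRrM powR_mulrn ?powR_ge0.
  by rewrite expr_div_n; lra.
by move=> k; apply: measurableT_comp; [exact: measurable_dyadic_term|].
Qed.

End DyadicMajorant.

Section Measurability.
Variables (R : realType).
Notation mu := (@lebesgue_measure R).

Lemma measurable_branch (g : {poly R}) : measurable_fun setT (fun z : R * R => z.2 + g.[z.1]).
Proof.
apply: measurable_funD; first exact: measurable_snd.
apply: (measurableT_comp (f := fun x : R => g.[x])); last exact: measurable_fst.
apply: continuous_measurable_fun; exact: continuous_horner.
Qed.

Lemma integral_dyadic_prod (theta : R) (g : {poly R}) : theta < 1 ->
  (\int[mu \x mu]_z (dyadic theta z.1 * dyadic theta (z.2 + g.[z.1])) < +oo)%E.
Proof.
move=> t1; have [Z [Z0 HZ]] := integral_dyadic_shift t1.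
have m1 : measurable_fun setT (fun z : R * R => dyadic theta z.1).
  by apply: measurableT_comp; [exact: measurable_dyadic|exact: measurable_fst].
have m2 : measurable_fun setT (fun z : R * R => dyadic theta (z.2 + g.[z.1])).
  by apply: (measurableT_comp (measurable_dyadic theta)); exact: measurable_branch.
have mD := measurable_dyadic theta.
rewrite fubini_tonelli1; first last.
- by move=> z; rewrite mule_ge0 // dyadic_ge0.
- exact: emeasurable_funM.
rewrite /fubini_F /=.
apply: (@le_lt_trans _ _ (\int[mu]_x (Z%:E * dyadic theta x))%E).
  apply: ge0_le_integral => //.
  - by move=> x _; apply: integral_ge0 => y _; rewrite mule_ge0 // dyadic_ge0.
  - apply: (measurable_fun_fubini_tonelli_F (m2 := mu)
      (fun z => dyadic theta z.1 * dyadic theta (z.2 + g.[z.1]))%E).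
      exact: emeasurable_funM.
    by move=> z; rewrite mule_ge0 // dyadic_ge0.
  - by apply: emeasurable_funM => //; exact: measurable_cst.
  move=> x _; rewrite ge0_integralZl //; first last.
  - exact: dyadic_ge0.
  - by move=> y _; exact: dyadic_ge0.
  - apply: (measurableT_comp mD); apply: measurable_funD => //.
  by rewrite muleC; apply: lee_wpmul2r; [exact: dyadic_ge0|exact: HZ].
rewrite ge0_integralZl_EFin //; last by move=> x _; exact: dyadic_ge0.
apply: (@le_lt_trans _ _ (Z%:E * Z%:E)%E); last by rewrite -EFinM ltry.
apply: lee_wpmul2l => //; apply: le_trans (HZ 0).
rewrite le_eqVlt; apply/orP; left; apply/eqP; apply: eq_integral => y _.
by rewrite addr0.
Qed.

Definition cmeasurable (D : set (R * R)) (f : R * R -> R[i]) :=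
  measurable_fun D (fun z => complex.Re (f z)) /\ measurable_fun D (fun z => complex.Im (f z)).

Lemma cmeasurable_mul D f g : cmeasurable D f -> cmeasurable D g ->
  cmeasurable D (fun z => f z * g z).
Proof.
move=> [fr fi] [gr gi]; split.
  have -> : (fun z => complex.Re (f z * g z)) = ((fun z => complex.Re (f z)) \* (fun z => complex.Re (g z)))
     \- ((fun z => complex.Im (f z)) \* (fun z => complex.Im (g z))).
    by apply/funext => z /=; case: (f z) (g z) => [a b] [c d].
  by apply: measurable_funB; apply: measurable_funM.
have -> : (fun z => complex.Im (f z * g z)) = ((fun z => complex.Re (f z)) \* (fun z => complex.Im (g z)))
     \+ ((fun z => complex.Im (f z)) \* (fun z => complex.Re (g z))).
  by apply/funext => z /=; case: (f z) (g z) => [a b] [c d].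
by apply: measurable_funD; apply: measurable_funM.
Qed.

Lemma cmeasurable_prod D (I : Type) (s : seq I) (F : I -> R * R -> R[i]) :
  (forall i, cmeasurable D (F i)) -> cmeasurable D (fun z => \prod_(i <- s) F i z).
Proof.
move=> mF; elim: s => [|i s IH].
  have -> : (fun z => \prod_(i <- [::]) F i z) = (fun=> 1).
    by apply/funext => z; rewrite big_nil.
  by split; exact: measurable_cst.
have -> : (fun z => \prod_(i <- i :: s) F i z) = (fun z => F i z * \prod_(i <- s) F i z).
  by apply/funext => z; rewrite big_cons.
exact: cmeasurable_mul.
Qed.

Lemma cmeasurable_inv D f : cmeasurable D f -> cmeasurable D (fun z => (f z)^-1).
Proof.
move=> [fr fi].
pose N z := complex.Re (f z) ^+ 2 + complex.Im (f z) ^+ 2.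
have mN : measurable_fun D N by apply: measurable_funD; apply: measurable_funX.
have mNV : measurable_fun D (fun z => (N z)^-1).
  (* For nonnegative reals, 0 included, inversion is the real power -1, whose measurability is
     known. *)
  have -> : (fun z => (N z)^-1) = (fun z => (N z) `^ (-1)).
    by apply/funext => z; rewrite powR_inv1 // addr_ge0 ?sqr_ge0.
  by apply: (measurableT_comp (measurable_powR (-1))).
split.
  have -> : (fun z => complex.Re (f z)^-1) = (fun z => complex.Re (f z)) \* (fun z => (N z)^-1).
    by apply/funext => z; rewrite /N /=; case: (f z).
  exact: measurable_funM.
have -> : (fun z => complex.Im (f z)^-1) = (\- (fun z => complex.Im (f z))) \* (fun z => (N z)^-1).
  by apply/funext => z; rewrite /N /=; case: (f z) => a b /=; rewrite mulNr.
by apply: measurable_funM => //; exact: measurable_funN.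
Qed.

Lemma measurable_cmod D f : cmeasurable D f -> measurable_fun D (fun z => cmod (f z)).
Proof.
move=> [fr fi]; apply: (measurableT_comp (f := @Num.sqrt R)).
  apply: continuous_measurable_fun; exact: sqrt_continuous.
by apply: measurable_funD; apply: measurable_funX.
Qed.

Lemma measurable_Lp_integrand D f (p : R) : cmeasurable D f ->
  measurable_fun D (fun z => ((cmod (f z)) `^ p)%:E).
Proof.
move=> /measurable_cmod mf; apply/measurable_EFinP.
exact: (measurableT_comp (measurable_powR p) mf).
Qed.

Lemma cmeasurable_Pval M (L : 'I_M -> nat) (q : 'I_M -> {poly R}) D :
  cmeasurable D (fun z => Pval L q z.1 z.2).
Proof.
apply: cmeasurable_prod => i; split.
  by apply: measurable_funS (measurable_branch (q i)).
by apply: measurable_funS (_ : measurable_fun setT _) => //; apply: measurable_funX; exact: measurable_fst.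
Qed.

Definition box (e : R) : set (R * R) := [set z | `|z.1| < e /\ `|z.2| < e].

Lemma measurable_box e : measurable (box e).
Proof.
have -> : box e = ((fst : R * R -> R) @^-1` `]-e, e[) `&` ((snd : R * R -> R) @^-1` `]-e, e[).
  by apply/seteqP; split=> [z [h1 h2]|z [/= + +]]; rewrite /= ?in_itv /= -!ltr_norml.
apply: measurableI; rewrite -[X in measurable X]setTI.
  by apply: (@measurable_fst _ _ R R) => //; exact: measurable_itv.
by apply: (@measurable_snd _ _ R R) => //; exact: measurable_itv.
Qed.

Lemma measurable_rpeval c (r B : R) : 0 <= r -> rconv c r B ->
  measurable_fun (box r) (fun z => rpeval c z.1 z.2).
Proof.
move=> r0 cB.
apply: (measurable_fun_cvg (h := fun N (z : R * R) => sqsum (fun i j => c i j * z.1 ^+ i * z.2 ^+ j) N)).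
  move=> N; apply: measurable_sum => i; apply: measurable_sum => j.
  apply: measurable_funM; first apply: measurable_funM.
  - exact: measurable_cst.
  - by apply: measurable_funX; apply: measurable_funTS; exact: measurable_fst.
  by apply: measurable_funX; apply: measurable_funTS; exact: measurable_snd.
by move=> z [h1 h2]; apply: (rpeval_cvg r0 cB); rewrite ltW.
Qed.

End Measurability.

(** * Real and imaginary parts of [Q], and sufficiency *)

Definition ReS (R : realType) (Q : cpseries R) i j := complex.Re (Q i j).
Definition ImS (R : realType) (Q : cpseries R) i j := complex.Im (Q i j).

Lemma ps_evalE (R : realType) (Q : cpseries R) x y :
  ps_eval Q x y = Complex (rpeval (ReS Q) x y) (rpeval (ImS Q) x y).
Proof. by []. Qed.

Lemma ps_convergentP (R : realType) (Q : cpseries R) : ps_convergent Q ->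
  exists r B, [/\ 0 < r, rconv (ReS Q) r B & rconv (ImS Q) r B].
Proof.
move=> [r [r0 [B HB]]]; exists r, B; split=> // N; apply: le_trans (HB N);
  apply: (@ler_sqsum _ _ (fun i j => cmod (Q i j) * r ^+ (i + j))) => i j;
  rewrite ler_wpM2r ?exprn_ge0 ?(ltW r0) //.
  exact: Re_le_cmod.
exact: Im_le_cmod.
Qed.

Lemma convergent_ps (R : realType) (Q : cpseries R) r B B' : 0 < r ->
  rconv (ReS Q) r B -> rconv (ImS Q) r B' -> ps_convergent Q.
Proof.
move=> r0 HB HB'; exists r; split=> //; exists (B + B') => N.
apply: le_trans (lerD (HB N) (HB' N)); rewrite -sqsumD.
apply: (@ler_sqsum _ (fun i j => cmod (Q i j) * r ^+ (i + j))) => i j.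
by rewrite -mulrDl ler_wpM2r ?exprn_ge0 ?(ltW r0) // cmod_le.
Qed.

Section Sufficiency.
Variables (R : realType) (M : nat) (L : 'I_M -> nat) (q : 'I_M -> {poly R}).
Variables (p : R) (Q : cpseries R).
Let O := Oij L q.
Let S := (\sum_i 2 * L i)%N.

Definition branch_cond (c : nat -> nat -> R) := forall j a b,
  (branch q (trunc S.+1 c) j)`_b`_a != 0 ->
  good p (2 * L j) (scale_sum O (2 * L j) j - (a + 2 * L j * b)).

Lemma Lp_loc_suff : (1 <= M)%N -> (forall j, (q j)`_0 = 0) -> 1 <= p -> ps_convergent Q ->
  branch_cond (ReS Q) -> branch_cond (ImS Q) ->
  Lp_loc p (fun z => ps_eval Q z.1 z.2 / Pval L q z.1 z.2).
Proof.
move=> M0 q0 p1 /ps_convergentP[r [B [r0 cR cI]]] condR condI.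
have [l [l0 lp lP]] := good_exponent S p1.
have p0 : 0 < p := lt_le_trans ltr01 p1.
pose th := l * p; have th0 : 0 < th by rewrite mulr_gt0.
have OP := OijP L q.
have [||d [K [d0 K0 HK]]] := @uniform_constants R 'I_M (fun j d K => forall x y,
    `|x| < d -> `|y| < d -> [/\ `|y + (q j).[x]| < 1 & x != 0 -> y + (q j).[x] != 0 ->
    (forall i, cmod (Pfactor L q j x y) <= cmod (Pfactor L q i x y)) ->
    cmod (ps_eval Q x y) * (`|x| * `|y + (q j).[x]|) `^ l <= K * cmod (Pval L q x y)]).
- move=> j d d' K K' d'0 dd K0 KK H x y xd yd.
  have [h1 h2] := H x y (lt_le_trans xd dd) (lt_le_trans yd dd); split=> // x0 u0 jm.
  by apply: le_trans (h2 x0 u0 jm) _; rewrite ler_wpM2r ?cmod_ge0.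
- move=> j.
  have sg c : branch_cond c -> forall m a b, (m <= 2 * L j)%N ->
      (branch q (trunc S.+1 c) j)`_b`_a != 0 -> good p m (scale_sum O m j - (a + m * b)).
    by move=> cc m a b mL nz; apply: (scale_good p1 OP cc).
  have [d1 [K1 [d10 K10 H1]]] := branch_bound l0 lP r0 cR (q0 j) (sg _ condR).
  have [d2 [K2 [d20 K20 H2]]] := branch_bound l0 lP r0 cI (q0 j) (sg _ condI).
  have [Cq [Cq0 HCq]] : exists C, 0 < C /\ forall x, `|x| <= 1 -> `|(q j).[x]| <= C * `|x| ^+ 1.
    by apply: poly_low_bound => -[|//] _.
  have C1 : 0 < 1 + Cq by lra.
  exists (Num.min (Num.min d1 d2) (Num.min 1 (1 + Cq)^-1)), (K1 + K2); split.
  - by rewrite !lt_min d10 d20 ltr01 invr_gt0.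
  - exact: addr_gt0.
  move=> x y; rewrite !lt_min => /andP[/andP[x1 x2] /andP[x3 x4]] /andP[/andP[y1 y2] /andP[_ y4]].
  split.
    have := HCq x (ltW x3); rewrite expr1 => h.
    have h1 : `|x| * (1 + Cq) < 1 by rewrite -ltr_pdivlMr ?div1r.
    have h2 : `|y| * (1 + Cq) < 1 by rewrite -ltr_pdivlMr ?div1r.
    apply: le_lt_trans (ler_normD _ _) _; apply: le_lt_trans (lerD (lexx _) h) _.
    apply: (@le_lt_trans _ _ (Num.max `|x| `|y| * (1 + Cq))).
      by rewrite mulrDr mulr1 [Cq * _]mulrC lerD ?ler_wpM2r ?(ltW Cq0) // le_max lexx ?orbT.
    by case: (leP `|x| `|y|).
  move=> x0 u0 jm.
  apply: le_trans (ler_wpM2r (powR_ge0 _ _) (cmod_le _)) _.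
  by rewrite !mulrDl lerD // ?H1 ?H2.
pose e := Num.min d (Num.min r 1).
have e0 : 0 < e by rewrite !lt_min d0 r0 ltr01.
have boxe (e' : R) : e <= e' -> box e `<=` box e'.
  by move=> ee z [h1 h2]; split; [exact: lt_le_trans h1 ee|exact: lt_le_trans h2 ee].
have mf : cmeasurable (box e) (fun z => ps_eval Q z.1 z.2 / Pval L q z.1 z.2).
  apply: cmeasurable_mul; last exact: cmeasurable_inv (cmeasurable_Pval _ _ _).
  have er : e <= r by rewrite !ge_min lexx orbT.
  by split; apply: (measurable_funS (measurable_box r) (boxe r er));
    [exact: measurable_rpeval (ltW r0) cR|exact: measurable_rpeval (ltW r0) cI].
exists (box e); split; first by exists e; split=> // z.
split; first exact: measurable_box.
have [mf1 mf2] := mf; do 2 split=> //.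
pose F (j : 'I_M) (z : R * R) : \bar R := (dyadic th z.1 * dyadic th (z.2 + (q j).[z.1]))%E.
have F0 j z : (0 <= F j z)%E by rewrite mule_ge0 ?dyadic_ge0.
have mF j : measurable_fun setT (F j).
  apply: emeasurable_funM; first by apply: measurableT_comp; [exact: measurable_dyadic|exact: measurable_fst].
  by apply: (measurableT_comp (measurable_dyadic th)); exact: measurable_branch.
pose K2 := K `^ p.
apply: (@le_lt_trans _ _ (\int[lebesgue_measure \x lebesgue_measure]_(z in box e)
   (K2%:E * \sum_(j < M) F j z))%E).
  apply: ge0_le_integral => //.
  - exact: measurable_box.
  - by move=> z _; rewrite lee_fin powR_ge0.
  - exact: measurable_Lp_integrand.
  - apply: measurable_funTS; apply: emeasurable_funM; first exact: measurable_cst.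
    by apply: emeasurable_sum; exact: mF.
  move=> [x y] [/= xe ye].
  have xd : `|x| < d by apply: lt_le_trans xe _; rewrite ge_min lexx.
  have yd : `|y| < d by apply: lt_le_trans ye _; rewrite ge_min lexx.
  have x1 : `|x| < 1 by apply: lt_le_trans xe _; rewrite !ge_min lexx !orbT.
  (* The closest branch varies with the point, so the majorant sums the contributions of all
     branches instead of splitting the box. *)
  pose j := [arg min_(i < Ordinal M0) cmod (Pfactor L q i x y)]%O.
  have jm i : cmod (Pfactor L q j x y) <= cmod (Pfactor L q i x y).
    by rewrite /j; case: arg_minP => // k _ /(_ i); apply.
  have [u1 Hj] := HK j x y xd yd.
  apply: (@le_trans _ _ (K2%:E * F j (x, y))%E); last first.
    apply: lee_wpmul2l; first by rewrite lee_fin powR_ge0.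
    by rewrite (bigD1 j) //= leeDl // sume_ge0.
  rewrite /F /=; set u := y + (q j).[x] in u1 Hj *.
  have dpos t : `|t| < 1 -> (0 < dyadic th t)%E.
    move=> t1; have [->|t0] := eqVneq t 0; first by rewrite dyadic0.
    apply: lt_le_trans (dyadic_lower th0 _); last by rewrite normr_gt0 t0.
    by rewrite lte_fin invr_gt0 powR_gt0 // normr_gt0.
  have K20 : (0 < K2%:E)%E by rewrite lte_fin powR_gt0.
  have [x0|x0] := eqVneq x 0.
    by rewrite x0 dyadic0 // gt0_mulye ?dpos // gt0_muley // leey.
  have [u0|u0] := eqVneq u 0.
    by rewrite u0 dyadic0 // gt0_muley ?dpos // gt0_muley // leey.
  have h := Hj x0 u0 jm.
  have nx : 0 < `|x| by rewrite normr_gt0.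
  have nu : 0 < `|u| by rewrite normr_gt0.
  apply: (@le_trans _ _ (K2%:E * (((`|x| `^ th)^-1)%:E * ((`|u| `^ th)^-1)%:E))%E); last first.
    apply: lee_wpmul2l; first exact: ltW.
    apply: lee_pmul; rewrite ?lee_fin ?invr_ge0 ?powR_ge0 //; apply: dyadic_lower => //.
      by rewrite nx.
    by rewrite nu.
  rewrite -!EFinM lee_fin -invfM -powRM // /K2 /th powRrM ler_pdivlMr ?powR_gt0 ?mulr_gt0 //.
  rewrite -powRM ?cmod_ge0 ?powR_ge0 // ge0_ler_powR ?nnegrE ?mulr_ge0 ?cmod_ge0 ?powR_ge0 ?(ltW K0) ?(ltW p0) //.
  rewrite cmod_div mulrAC.
  have [->|P0] := eqVneq (cmod (Pval L q x y)) 0; first by rewrite invr0 mulr0 ltW.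
  by rewrite ler_pdivrMr // lt_def P0 cmod_ge0.
apply: (@le_lt_trans _ _ (\int[lebesgue_measure \x lebesgue_measure]_z
   (K2%:E * \sum_(j < M) F j z))%E).
  apply: ge0_subset_integral => //.
  - exact: measurable_box.
  - apply: emeasurable_funM; first exact: measurable_cst.
    by apply: emeasurable_sum; exact: mF.
  - by move=> z _; rewrite mule_ge0 ?lee_fin ?powR_ge0 // sume_ge0.
rewrite ge0_integralZl_EFin ?powR_ge0 //; first last.
- by apply: emeasurable_sum; exact: mF.
- by move=> z _; rewrite sume_ge0.
rewrite ge0_integral_sum //.
apply: lte_mul_pinfty; rewrite ?lee_fin ?powR_ge0 //.
by apply: lte_sum_pinfty => j _; apply: integral_dyadic_prod.
Qed.

End Sufficiency.

(** * Divergence along a branch *)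

Section Divergence.
Variables (R : realType) (q : {poly R}) (n : nat) (tau : R).
Hypothesis tau0 : 0 < tau.
Notation mu := (@lebesgue_measure R).

(** The curves [y = x^n t - q(x)] with [t] in [[tau, 2 tau]]; [tau] will be chosen so that the
    leading form has no zero there. *)
Definition horn (a b : R) : set (R * R) :=
  [set z | a < z.1 <= b /\ tau * z.1 ^+ n <= z.2 + q.[z.1] <= 2 * tau * z.1 ^+ n].

Lemma measurable_horn a b : measurable (horn a b).
Proof.
have mx (c : R) : measurable_fun setT (fun z : R * R => c * z.1 ^+ n).
  by apply: measurable_funM; [exact: measurable_cst|apply: measurable_funX; exact: measurable_fst].
have -> : horn a b = ((fst : R * R -> R) @^-1` `]a, b]) `&`
   ((fun z : R * R => (z.2 + q.[z.1]) - tau * z.1 ^+ n) @^-1` `[0, +oo[) `&`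
   ((fun z : R * R => 2 * tau * z.1 ^+ n - (z.2 + q.[z.1])) @^-1` `[0, +oo[).
  apply/seteqP; split=> [z [h1 /andP[h2 h3]]|z [[/= + +] +]];
    rewrite /= !in_itv /= ?andbT ?subr_ge0 //.
  by move=> h1 h2 h3; split=> //; rewrite h2 h3.
apply: measurableI; first apply: measurableI; rewrite -[X in measurable X]setTI.
- by apply: (@measurable_fst _ _ R R) => //; exact: measurable_itv.
- by apply: measurable_funB; [exact: measurable_branch|exact: mx|by []|exact: measurable_itv].
- by apply: measurable_funB; [exact: mx|exact: measurable_branch|by []|exact: measurable_itv].
Qed.

Lemma horn_measure a b : 0 <= a -> a <= b ->
  ((tau * a ^+ n * (b - a))%:E <= (mu \x mu)%E (horn a b))%E.
Proof.
move=> a0 ab; rewrite /= /product_measure1 /=.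
apply: (@le_trans _ _ (\int[mu]_x ((tau * a ^+ n)%:E * (\1_(`]a, b]%classic : set R) x)%:E))%E).
  have -> : (\int[mu]_x ((tau * a ^+ n)%:E * (\1_(`]a, b]%classic : set R) x)%:E) =
      (tau * a ^+ n)%:E * \int[mu]_x (\1_(`]a, b]%classic : set R) x)%:E)%E.
    apply: ge0_integralZl_EFin => //.
      by apply/measurable_EFinP; apply: measurable_indic; exact: measurable_itv.
    by rewrite mulr_ge0 ?exprn_ge0 // ltW.
  rewrite integral_indic //= setIT.
  rewrite [X in (_ <= _ * X)%E](_ : _ = (b - a)%:E).
    by rewrite -EFinM.
  etransitivity; first exact: lebesgue_measure_itv.
  rewrite /= lte_fin; case: ltP => // ba.
  by rewrite (@le_anti _ _ a b) ?ab // subrr.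
apply: ge0_le_integral => //.
- by move=> x _; rewrite mule_ge0 // lee_fin ?mulr_ge0 ?exprn_ge0 ?(ltW tau0) // indicE ler0n.
- apply: emeasurable_funM; first exact: measurable_cst.
  by apply/measurable_EFinP; apply: measurable_indic; exact: measurable_itv.
- exact: (measurable_fun_xsection mu (measurable_horn a b)).
move=> x _; rewrite indicE; case: (boolP (x \in _)) => [|_]; last by rewrite mule0.
move=> /set_mem /=; rewrite in_itv /= => /andP[ax xb]; rewrite mule1.
have -> : xsection (horn a b) x = `[tau * x ^+ n - q.[x], 2 * tau * x ^+ n - q.[x]]%classic.
  apply/seteqP; split=> y; rewrite /xsection /= in_itv /=.
    by move=> /set_mem[_ /= /andP[h1 h2]]; apply/andP; split; lra.
  by move=> /andP[h1 h2]; apply/mem_set; split=> /=; [rewrite ax|apply/andP; split; lra].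
have h : tau * a ^+ n <= tau * x ^+ n.
  by rewrite ler_wpM2l ?(ltW tau0) // lerXn2r ?nnegrE // ltW // (le_lt_trans a0).
have h0 : 0 <= tau * a ^+ n by rewrite mulr_ge0 ?exprn_ge0 // ltW.
rewrite lebesgue_measure_itv /= lte_fin; case: ltP => hh.
  by rewrite -EFinB lee_fin; lra.
by rewrite lee_fin; lra.
Qed.

Lemma horn_integral_infty (x0 kappa : R) (U : set (R * R)) (g : R * R -> \bar R) :
  0 < x0 -> 0 < kappa -> measurable U -> measurable_fun U g ->
  (forall z, U z -> (0 <= g z)%E) -> horn 0 x0 `<=` U ->
  (forall z, horn 0 x0 z -> ((kappa / z.1 ^+ n.+1)%:E <= g z)%E) ->
  (\int[mu \x mu]_(z in U) g z = +oo)%E.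
Proof.
move=> x00 k0 mU mg g0 hU Hg.
pose a k := x0 / 2 ^+ k.
have a0 k : 0 < a k by rewrite divr_gt0 ?exprn_gt0.
have aS k : a k = 2 * a k.+1.
  by rewrite /a exprS invfM [RHS]mulrCA [2 * _]mulrA divff // mul1r.
have ale k l : (k <= l)%N -> a l <= a k.
  by move=> kl; rewrite /a ler_wpM2l ?(ltW x00) // lef_pV2 ?posrE ?exprn_gt0 // ler_eXn2l //; lra.
have ax0 k : a k <= x0 by have := ale 0%N k isT; rewrite {2}/a expr0 divr1.
pose H k := horn (a k.+1) (a k).
have mH k : measurable (H k) := measurable_horn _ _.
have HU k : H k `<=` horn 0 x0.
  move=> z [/andP[h1 h2] h3]; split=> //; apply/andP; split.
    exact: lt_trans h1.
  exact: le_trans h2 (ax0 k).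
(* The slab between [a k.+1] and [a k = 2 * a k.+1] has measure at least [tau * a k.+1 ^+ n.+1], and
   [g] is at least [kappa / a k ^+ n.+1] on it. So every slab contributes at least [om]. *)
pose om := kappa * tau / 2 ^+ n.+1.
have om0 : 0 < om by rewrite divr_gt0 ?mulr_gt0 ?exprn_gt0.
have Hint k : (om%:E <= \int[mu \x mu]_(z in H k) g z)%E.
  apply: (@le_trans _ _ (\int[mu \x mu]_(z in H k) (kappa / a k ^+ n.+1)%:E)%E).
    rewrite integral_cst /=; last exact: mH.
    apply: (@le_trans _ _ ((kappa / a k ^+ n.+1)%:E * (tau * a k.+1 ^+ n * (a k - a k.+1))%:E)%E).
      rewrite -EFinM lee_fin /om.
      have -> : a k - a k.+1 = a k.+1 by rewrite [a k]aS; lra.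
      rewrite [a k]aS exprMn -[tau * _ * _]mulrA -exprSr.
      have : a k.+1 ^+ n.+1 != 0 by rewrite expf_neq0 // gt_eqF.
      have : 2 ^+ n.+1 != 0 :> R by rewrite expf_neq0.
      move: (2 ^+ n.+1) (a k.+1 ^+ n.+1) => X Y X0 Y0.
      by rewrite le_eqVlt; apply/orP; left; apply/eqP; field; rewrite X0 Y0.
    apply: lee_wpmul2l; first by rewrite lee_fin divr_ge0 ?exprn_ge0 ?(ltW k0) // ltW.
    by apply: horn_measure; [exact: ltW|exact: ale].
  apply: ge0_le_integral => //.
  - exact: mH.
  - by move=> z _; rewrite lee_fin divr_ge0 ?exprn_ge0 ?(ltW k0) // ltW.
  - by apply: measurable_funS mg => // z /HU /hU.
  move=> z Hz; apply: le_trans (Hg z (HU k z Hz)); rewrite lee_fin.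
  have [/andP[h1 h2] _] := Hz; have z0 : 0 < z.1 := lt_trans (a0 _) h1.
  by rewrite ler_wpM2l ?(ltW k0) // lef_pV2 ?posrE ?exprn_gt0 // lerXn2r ?nnegrE // ltW.
apply/eqyP => A A0; have [N NA] : exists N : nat, A / om <= N%:R.
  by exists (Num.truncn (A / om)).+1; rewrite ltW // truncnS_gt.
have triv : trivIset setT H.
  move=> k l _ _ [z [[/andP[h1 h2] _] [/andP[h3 h4] _]]]; apply/eqP; rewrite eqn_leq.
  apply/andP; split; rewrite leqNgt; apply/negP => /ale h.
    by have := lt_le_trans h3 (le_trans h2 h); rewrite ltxx.
  by have := lt_le_trans h1 (le_trans h4 h); rewrite ltxx.
have UH : \big[setU/set0]_(k <- iota 0 N) H k `<=` U.
  by rewrite -bigcup_seq => z [k _ /HU /hU].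
apply: (@le_trans _ _ (\int[mu \x mu]_(z in \big[setU/set0]_(k <- iota 0 N) H k) g z)%E); last first.
  by apply: ge0_subset_integral => //; apply: bigsetU_measurable => k _; exact: mH.
have -> : (\int[mu \x mu]_(z in \big[setU/set0]_(k <- iota 0 N) H k) g z =
    \sum_(k <- iota 0 N) \int[mu \x mu]_(z in H k) g z)%E.
  apply: ge0_integral_bigsetU.
  - exact: mH.
  - exact: iota_uniq.
  - exact: sub_trivIset triv.
  - exact: measurable_funS mg.
  - by move=> z /UH /g0.
apply: (@le_trans _ _ (\sum_(k <- iota 0 N) om%:E)%E); last exact: lee_sum.
rewrite sumEFin lee_fin big_const_seq count_predT size_iota iter_addr_0.
by rewrite -mulr_natr mulrC -ler_pdivrMr.
Qed.

End Divergence.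

(** * Coefficients and lower bounds after the substitution *)

Lemma small_poly_coef (R : realFieldType) (g : {poly R}) m (C d : R) : 0 < d ->
  (forall x, 0 < `|x| < d -> `|g.[x]| <= C * `|x| ^+ m) -> forall a, (a < m)%N -> g`_a = 0.
Proof.
move=> d0 Hg a am; apply/eqP; apply: contraT => ga.
have exo : exists o, (o < m)%N && (g`_o != 0) by exists a; rewrite am.
case: (ex_minnP exo) => o /andP[om go] omin.
have [d' [c [d'0 c0 Hc]]] : exists d c, [/\ 0 < d, 0 < c & forall x, `|x| <= d ->
    c * `|x| ^+ o <= `|g.[x]|].
  apply: poly_low_lower => // b bo; apply/eqP; apply: contraT => gb.
  by have := omin b; rewrite (ltn_trans bo om) gb leqNgt bo => /(_ isT).
pose K := `|C| + 1; have K0 : 0 < K by rewrite ltr_wpDl.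
pose x := Num.min (Num.min (d / 2) d') (Num.min 1 (c / 2 / K)).
have x0 : 0 < x by rewrite !lt_min ltr01 d'0 !divr_gt0.
have xd : x <= d / 2 by rewrite !ge_min lexx.
have xd' : x <= d' by rewrite !ge_min lexx orbT.
have x1 : x <= 1 by rewrite !ge_min lexx !orbT.
have xK : x <= c / 2 / K by rewrite !ge_min lexx !orbT.
have nx : `|x| = x by rewrite ger0_norm // ltW.
have h1 := Hc x; rewrite nx in h1; have {}h1 := h1 xd'.
have h2 := Hg x; rewrite nx in h2.
have {}h2 : `|g.[x]| <= C * x ^+ m by apply: h2; rewrite x0 (le_lt_trans xd) //; lra.
have h3 : C * x ^+ m <= K * x ^+ o.+1.
  apply: (@le_trans _ _ (K * x ^+ m)).
    rewrite ler_wpM2r ?exprn_ge0 ?(ltW x0) //; have := ler_norm C; rewrite /K; lra.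
  by rewrite ler_wpM2l ?(ltW K0) // ler_wiXn2l // ltW.
have := le_trans h1 (le_trans h2 h3); rewrite exprS mulrA ler_pM2r ?exprn_gt0 //.
have : K * x <= c / 2 by rewrite mulrC -ler_pdivlMr.
lra.
Qed.

Section BlowupBounds.
Variables (R : realType) (c : nat -> nat -> R) (r B : R) (n : nat) (q : {poly R}).
Hypotheses (r0 : 0 < r) (cB : rconv c r B) (n0 : (0 < n)%N) (q0 : q`_0 = 0).

(** As [n > 0] and [q(0) = 0], the substituted [y] is [O(|x|)] uniformly in [t], so the truncation
    error is [O(|x|^D)]. *)
Lemma trunc_blowup_bound D : exists d T, [/\ 0 < d, 0 < T, d <= 1 &
  forall x t, `|x| <= d -> `|t| <= 1 ->
   `|rpeval c x (x ^+ n * t - q.[x]) - ev (trunc D c \Po blowup n q) x t| <= T * `|x| ^+ D].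
Proof.
have [Cq [Cq0 HCq]] : exists C, 0 < C /\ forall x, `|x| <= 1 -> `|q.[x]| <= C * `|x| ^+ 1.
  by apply: poly_low_bound => -[|//] _.
have B0 : 0 <= B by have := cB 0%N; rewrite /sqsum big_ord0.
pose E := r ^- D * B; have E0 : 0 <= E by rewrite mulr_ge0 // invr_ge0 exprn_ge0 // ltW.
have C1 : 0 < 1 + Cq by lra.
exists (Num.min 1 (Num.min r (r / (1 + Cq)))), (E * (1 + (1 + Cq) ^+ D) + 1); split.
- by rewrite !lt_min ltr01 r0 divr_gt0.
- by rewrite ltr_wpDl // mulr_ge0 // addr_ge0 // exprn_ge0 // ltW.
- by rewrite ge_min lexx.
move=> x t; rewrite !le_min => /and3P[x1 xr xC] t1.
have hy : `|x ^+ n * t - q.[x]| <= (1 + Cq) * `|x|.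
  apply: le_trans (ler_normB _ _) _; rewrite mulrDl mul1r lerD //.
    rewrite normrM normrX -[leRHS]mulr1 ler_pM ?exprn_ge0 //.
    by rewrite -[leRHS]expr1 ler_wiXn2l.
  by have := HCq x x1; rewrite expr1.
rewrite ev_comp ev_blowup ev_trunc.
apply: le_trans (trunc_bound D r0 cB xr _) _.
  by apply: le_trans hy _; rewrite mulrC -ler_pdivlMr.
rewrite -/E.
have h : `|x ^+ n * t - q.[x]| ^+ D <= ((1 + Cq) * `|x|) ^+ D.
  by rewrite lerXn2r ?nnegrE // mulr_ge0 // ltW.
apply: (@le_trans _ _ (E * (1 + (1 + Cq) ^+ D) * `|x| ^+ D)); last first.
  by rewrite [leRHS]mulrDl lerDl mul1r exprn_ge0.
by rewrite -[leRHS]mulrA ler_wpM2l // [leRHS]mulrDl mul1r lerD2l -exprMn.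
Qed.

(** For each small [t != 0] the truncated substitution is [O(|x|^min(k, D))] in [x], so its
    coefficient of [x^a] vanishes. That coefficient is a polynomial in [t] vanishing on a punctured
    interval, hence zero. *)
Lemma xpow_divides_coef D k (G : nat -> nat -> R) r' B' e : 0 < r' -> rconv G r' B' -> 0 < e ->
  (forall x y, `|x| < e -> `|y| < e ->
     rpeval c x (x ^+ n * y - q.[x]) = x ^+ k * rpeval G x y) ->
  forall a b, (a < k)%N -> (a < D)%N -> (trunc D c \Po blowup n q)`_b`_a = 0.
Proof.
move=> r'0 GB e0 HG a b ak aD.
have [d [T [d0 T0 d1 HT]]] := trunc_blowup_bound D.
set H := trunc D c \Po blowup n q in HT *.
have B'0 : 0 <= B' by have := GB 0%N; rewrite /sqsum big_ord0.
pose d' := Num.min (Num.min d e) (Num.min 1 r').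
have d'0 : 0 < d' by rewrite !lt_min d0 e0 ltr01.
have van t : 0 < `|t| < d' -> (H.[t%:P])`_a = 0.
  rewrite !lt_min => /and3P[_ /andP[td te] /andP[t1 tr]].
  apply: (@small_poly_coef _ _ (minn k D) (B' + T) d' d'0); last by rewrite leq_min ak.
  move=> x; rewrite !lt_min => /and3P[x0 /andP[xd xe] /andP[x1 xr]].
  have := HT x t (ltW xd) (ltW t1); rewrite HG // -/(ev H x t) => h1.
  have h2 : `|x ^+ k * rpeval G x t| <= B' * `|x| ^+ k.
    rewrite normrM normrX mulrC ler_wpM2r ?exprn_ge0 //.
    by apply: (rpeval_bound (ltW r'0) GB); rewrite ltW.
  have h3 : B' * `|x| ^+ k <= B' * `|x| ^+ minn k D.
    by rewrite ler_wpM2l // ler_wiXn2l ?geq_minl // ltW.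
  have h4 : T * `|x| ^+ D <= T * `|x| ^+ minn k D.
    by rewrite ler_wpM2l ?(ltW T0) // ler_wiXn2l ?geq_minr // ltW.
  rewrite -[ev H x t](subKr (x ^+ k * rpeval G x t)).
  apply: le_trans (ler_normB _ _) _; rewrite mulrDl lerD //.
    exact: le_trans h3.
  exact: le_trans h4.
pose g := map_poly (coefp a) H.
have gE t : g.[t] = (H.[t%:P])`_a.
  rewrite /g /map_poly horner_poly horner_coef coef_sum; apply: eq_bigr => i _.
  by rewrite -rmorphXn coefMC.
have := @small_poly_coef _ g b.+1 0 d' d'0; rewrite /g.
move=> /(_ _ b (ltnSn b)); rewrite coef_map_id0 ?coefp0 /=; first apply.
  by move=> t td; rewrite -/g gE van // normr0 mul0r.
by rewrite coef0.
Qed.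

Lemma leading_lower_bound D K : weight_ge n K (trunc D c \Po ('X - q%:P)) ->
  lead_form n K (trunc D c \Po ('X - q%:P)) != 0 -> (K < D)%N ->
  exists x0 tau gamma, [/\ 0 < x0, 0 < tau, tau <= 2^-1, 0 < gamma &
    forall x t, 0 < x <= x0 -> tau <= t <= 2 * tau ->
    gamma * x ^+ K <= `|rpeval c x (x ^+ n * t - q.[x])|].
Proof.
set P := trunc D c \Po _ => wP; set g := lead_form n K P => g0 KD.
have [d [T [d0 T0 d1 HT]]] := trunc_blowup_bound D.
have [V VE] := wsubst_factor wP.
have [_ gV] := factor_wsubst VE; rewrite -/g in gV.
have HV : trunc D c \Po blowup n q = ('X^K)%:P * V.
  rewrite -VE /wsubst /P -comp_polyA rmorphB /= comp_polyX comp_polyC //.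
have [d1' [c1 [d10 c10 Hg]]] : exists d c, [/\ 0 < d, 0 < c & forall x, `|x| <= d ->
    c * `|x| ^+ ordp g <= `|g.[x]|].
  apply: poly_low_lower; first exact/(leq_ordp _ g0).
  exact: coef_ordp.
(* Thus [[tau, 2 tau]] lies where the lowest term of [g] bounds [|g|] below, away from the possible
   zero at 0. *)
pose tau := Num.min d1' 1 / 2.
have tau0 : 0 < tau by rewrite divr_gt0 // lt_min d10 ltr01.
have tau1 : 2 * tau <= 1 by rewrite mulrC divfK // ge_min lexx orbT.
have taud : 2 * tau <= d1' by rewrite mulrC divfK // ge_min lexx.
have [CV [CV0 HCV]] : exists C, 0 < C /\ forall x t, `|x| <= 1 -> `|t| <= 1 ->
    `|ev V x t - g.[t]| <= C * `|x|.
  pose V1 := map_poly (drop_poly 1) V.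
  have V1E : V = 'X%:P * V1 + map_poly polyC g.
    apply/polyP => b; rewrite coefD coefCM !coef_map_id0 ?polyC0 ?linear0 //.
    rewrite gV coef_map /= /horner_eval horner_coef0 -{1}[V`_b](poly_take_drop 1) addrC mulrC expr1.
    congr (_ + _); apply/polyP => a; rewrite coef_take_poly coefC.
    by case: a.
  have [N HN] := psq_ev V1.
  exists (1 + sqsum (fun a b => `|V1`_b`_a|) N); split.
    by rewrite ltr_wpDr // sumr_ge0 // => a _; rewrite sumr_ge0.
  move=> x t x1 t1.
  have -> : ev V x t - g.[t] = x * ev V1 x t.
    rewrite {1}V1E /ev hornerD hornerM hornerC hornerD hornerM hornerX.
    have -> : (map_poly polyC g).[t%:P].[x] = g.[t].
      by rewrite horner_map hornerC.
    by rewrite addrK.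
  rewrite normrM mulrC ler_wpM2r // -(HN N) // /psq /sqsum.
  apply: ler_wpDl => //; apply: le_trans (ler_norm_sum _ _ _) _; apply: ler_sum => a _.
  apply: le_trans (ler_norm_sum _ _ _) _; apply: ler_sum => b _.
  rewrite !normrM !normrX -mulrA ler_piMr // mulr_ile1 ?exprn_ge0 // exprn_ile1 //.
pose gam := c1 * tau ^+ ordp g.
have gam0 : 0 < gam by rewrite mulr_gt0 ?exprn_gt0.
(* The terms of weight above [K] and the truncation error then take away at most half of [gam];
   [K < D] is what makes the latter of higher order. *)
pose x0 := Num.min d (gam / 2 / (CV + T)).
exists x0, tau, (gam / 2); split=> //.
- by rewrite lt_min d0 !divr_gt0 // addr_gt0.
- by lra.
- by rewrite divr_gt0.
move=> x t /andP[x_gt0]; rewrite le_min => /andP[xd xg] /andP[t1 t2].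
have nx : `|x| = x by rewrite ger0_norm // ltW.
have nt : `|t| = t by rewrite ger0_norm // (le_trans (ltW tau0)).
have t1' : `|t| <= 1 by rewrite nt (le_trans t2).
have h1 := HT x t; rewrite nx in h1; have {}h1 := h1 xd t1'.
have x1 : x <= 1 := le_trans xd d1.
have h2 := HCV x t; rewrite nx in h2; have {}h2 := h2 x1 t1'.
have h3 : gam <= `|g.[t]|.
  apply: le_trans (Hg t _); last by rewrite nt (le_trans t2).
  by rewrite ler_wpM2l ?(ltW c10) // nt lerXn2r ?nnegrE ?(ltW tau0) // (le_trans (ltW tau0)).
have h4 : x * (CV + T) <= gam / 2 by rewrite -ler_pdivlMr // addr_gt0.
have evE : ev (trunc D c \Po blowup n q) x t = x ^+ K * ev V x t.
  by rewrite HV /ev hornerM hornerC hornerM hornerXn.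
have xK : 0 < x ^+ K by rewrite exprn_gt0.
have h5 : T * x ^+ D <= x ^+ K * (T * x).
  rewrite mulrCA -exprSr ler_wpM2l ?(ltW T0) // ler_wiXn2l // ltW //.
have h6 : gam - CV * x <= `|ev V x t|.
  have := lerB_dist g.[t] (g.[t] - ev V x t); rewrite subKr => h.
  have : `|g.[t] - ev V x t| <= CV * x by rewrite distrC.
  lra.
have h7 : x ^+ K * (gam - CV * x) <= `|ev (trunc D c \Po blowup n q) x t|.
  by rewrite evE normrM normrX nx ler_wpM2l // ltW.
set Y := rpeval c x _ in h1 *; set Z := ev _ x t in h1 h7.
have h8 : `|Z| - `|Z - Y| <= `|Y|.
  have := lerB_dist Z (Z - Y); rewrite subKr; lra.
have h9 : `|Z - Y| <= x ^+ K * (T * x) by rewrite distrC; exact: le_trans h5.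
have h10 : x ^+ K * (gam / 2) <= x ^+ K * (gam - CV * x - T * x).
  by rewrite ler_wpM2l ?(ltW xK) //; lra.
rewrite mulrC; apply: le_trans h10 _; apply: le_trans h8.
by rewrite mulrBr lerB.
Qed.

End BlowupBounds.

(** An integer is less than [(n + 1) / p] exactly when it is less than its ceiling. Truncating
    [S - k] at 0 is harmless because that ceiling is positive. *)
Lemma goodE (R : realType) (p : R) n S k : 1 <= p ->
  good p n (S - k) = (S%:Z - Num.ceil ((n + 1)%:R / p : R) + 1 <= k%:Z).
Proof.
move=> p1; have p0 : 0 < p := lt_le_trans ltr01 p1.
rewrite /good -ltr_pdivlMr // -addn1 [(S - k)%:R]pmulrn -ceil_gt_int.
have c1 : 0 < Num.ceil ((n + 1)%:R / p : R) by rewrite ceil_gt_int mulr0z divr_gt0 // ltr0n addn1.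
move: (Num.ceil _) c1 => c c1; have [Sk|kS] := leqP S k.
  have -> : (S - k)%N = 0%N by lia.
  by rewrite c1; apply/esym; lia.
by rewrite -subzn 1?ltnW //; apply/idP/idP; lia.
Qed.

Lemma branch_wsubst (R : realType) (M : nat) (q : 'I_M -> {poly R}) C n j :
  C \Po blowup n (q j) = wsubst n (branch q C j).
Proof. by rewrite /wsubst /branch -comp_polyA rmorphB /= comp_polyX comp_polyC. Qed.

Lemma coef_branch_blowup (R : realType) (M : nat) (q : 'I_M -> {poly R}) C n j a b :
  (C \Po blowup n (q j))`_b`_(a + n * b) = (branch q C j)`_b`_a.
Proof. by rewrite branch_wsubst coef_wsubst coefMXn ltnNge leq_addl /= addnK. Qed.

(** * Necessity *)

Section Necessity.
Variables (R : realType) (M : nat) (L : 'I_M -> nat) (q : 'I_M -> {poly R}).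
Variables (p : R) (Q : cpseries R) (c : nat -> nat -> R) (r B : R).
Let O := Oij L q.
Let S := (\sum_i 2 * L i)%N.
Hypotheses (L0 : forall j, (0 < L j)%N) (q0 : forall j, (q j)`_0 = 0) (p1 : 1 <= p).
Hypotheses (r0 : 0 < r) (cB : rconv c r B).
Hypothesis cQ : forall x y, `|rpeval c x y| <= cmod (ps_eval Q x y).

Lemma scale_sum_end j : scale_sum O (2 * L j) j = (\sum_i O i j)%N.
Proof.
apply: eq_bigr => i _; apply/minn_idPl.
by have [] := (OijP L q i j _).1 (leqnn (O i j)).
Qed.

Lemma Lp_loc_nec D j a b : Lp_loc p (fun z => ps_eval Q z.1 z.2 / Pval L q z.1 z.2) ->
  (S < D)%N -> (branch q (trunc D c) j)`_b`_a != 0 ->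
  good p (2 * L j) ((\sum_i O i j) - (a + 2 * L j * b)).
Proof.
move=> [U [[e [e0 eU]] [mU [mR [mI fin]]]]] SD nz; apply: contraT => ng.
set n := (2 * L j)%N in ng *.
have n0 : (0 < n)%N by rewrite muln_gt0 L0.
have [K [Kle wK lK]] := lead_form_exists n nz.
(* The minimal weight [K] is at most that of the given monomial, so the inequality fails for it
   too. *)
have {}ng : ~~ good p n ((\sum_i O i j) - K) by apply: contra ng => g; apply: (good_le p1 _ g); rewrite leq_sub2l.
set s := (\sum_i O i j - K)%N in ng.
have sn : n.+1%:R <= s%:R * p by rewrite leNgt.
have s0 : (0 < s)%N by rewrite lt0n; apply: contraTneq sn => ->; rewrite mul0r -ltNge ltr0n.
have OS : (\sum_i O i j <= S)%N by rewrite -scale_sum_end scale_sum_le.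
have KD : (K < D)%N by lia.
have [x0 [tau [gam [x00 tau0 tau1 gam0 Hlow]]]] := leading_lower_bound r0 cB n0 (q0 j) wK lK KD.
have /choice[C HC] : forall i, exists C, 0 < C /\ forall x t, `|x| <= 1 -> `|t| <= 1 ->
   cmod (Pfactor L q i x (x ^+ n * t - (q j).[x])) <= C * `|x| ^+ O i j.
  by move=> i; exact: Pfactor_upper.
pose Cp := \prod_i C i.
have Cp0 : 0 < Cp by apply: prodr_gt0 => i _; have [] := HC i.
have [Cq [Cq0 HCq]] : exists C, 0 < C /\ forall x, `|x| <= 1 -> `|(q j).[x]| <= C * `|x| ^+ 1.
  by apply: poly_low_bound => -[|//] _.
(* The last bound keeps the horn inside the box of radius [e], since [|y| <= (1 + Cq) |x|] on it. *)
pose x1 := Num.min (Num.min x0 1) (e / (2 * (1 + Cq))).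
have Cq1 : 0 < 2 * (1 + Cq) by apply: mulr_gt0; lra.
have x10 : 0 < x1 by rewrite !lt_min x00 ltr01 divr_gt0.
pose kappa := (gam / Cp) `^ p.
have kappa0 : 0 < kappa by rewrite powR_gt0 // divr_gt0.
suff : (\int[lebesgue_measure \x lebesgue_measure]_(z in U)
    ((cmod (ps_eval Q z.1 z.2 / Pval L q z.1 z.2)) `^ p)%:E = +oo)%E.
  by move=> h; move: fin; rewrite h ltxx.
have hornP z : horn (q j) n tau 0 x1 z -> exists t, [/\ 0 < z.1, z.1 <= x0, z.1 <= 1,
    z.1 * (2 * (1 + Cq)) <= e & tau <= t <= 2 * tau /\ z.2 = z.1 ^+ n * t - (q j).[z.1]].
  move=> [/andP[z0]]; rewrite !le_min => /andP[/andP[h1 h2] h3] /andP[h4 h5].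
  have zn : 0 < z.1 ^+ n by rewrite exprn_gt0.
  exists ((z.2 + (q j).[z.1]) / z.1 ^+ n); split=> //.
    by rewrite -ler_pdivlMr.
  rewrite ler_pdivlMr // ler_pdivrMr // h4 h5; split=> //.
  by rewrite mulrC divfK ?gt_eqF // addrK.
apply: (@horn_integral_infty R (q j) n tau tau0 x1 kappa) => //.
- exact: measurable_Lp_integrand.
- by move=> z _; rewrite lee_fin powR_ge0.
- move=> z /hornP[t [z0 zx0 z1 ze [/andP[t1 t2] zE]]]; apply: eU.
  have nz1 : `|z.1| = z.1 by rewrite ger0_norm // ltW.
  have nt : `|t| <= 1 by rewrite ger0_norm ?(le_trans (ltW tau0)) // (le_trans t2) //; lra.
  have zC : 0 <= z.1 * Cq by rewrite mulr_ge0 // ltW.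
  have h : z.1 + Cq * z.1 < e by move: ze; rewrite !mulrDr !mulr1 [Cq * _]mulrC; lra.
  split; rewrite /=; first by rewrite nz1; move: h; rewrite [Cq * _]mulrC; lra.
  apply: le_lt_trans h; rewrite zE; apply: le_trans (ler_normB _ _) _; apply: lerD.
    rewrite normrM normrX nz1 -[leRHS]mulr1 ler_pM ?exprn_ge0 ?(ltW z0) //.
    by rewrite -[leRHS]expr1 ler_wiXn2l // ltW.
  by have := HCq z.1; rewrite nz1 expr1; apply.
move=> z /hornP[t [z0 zx0 z1 ze [/andP[t1 t2] zE]]].
have nz1 : `|z.1| = z.1 by rewrite ger0_norm // ltW.
have nt : `|t| <= 1 by rewrite ger0_norm ?(le_trans (ltW tau0)) // (le_trans t2) //; lra.
have hQ : gam * z.1 ^+ K <= cmod (ps_eval Q z.1 z.2).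
  by apply: le_trans (cQ _ _); rewrite zE; apply: Hlow; apply/andP.
have P0 : 0 < cmod (Pval L q z.1 z.2).
  rewrite cmod_Pval; apply: prodr_gt0 => i _; apply: lt_le_trans (Im_le_cmod _).
  by rewrite normr_gt0 expf_neq0 // gt_eqF.
have hP : cmod (Pval L q z.1 z.2) <= Cp * z.1 ^+ (\sum_i O i j).
  rewrite cmod_Pval /Cp -prodrXr -big_split; apply: ler_prod => i _.
  rewrite cmod_ge0 zE; have [_ /(_ z.1 t)] := HC i; rewrite nz1; exact.
rewrite lee_fin cmod_div.
have hs : (\sum_i O i j = s + K)%N by rewrite /s subnK // ltnW // -subn_gt0.
have hf : gam / Cp / z.1 ^+ s <= cmod (ps_eval Q z.1 z.2) / cmod (Pval L q z.1 z.2).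
  rewrite ler_pdivlMr //; apply: le_trans hQ.
  apply: (@le_trans _ _ (gam / Cp / z.1 ^+ s * (Cp * z.1 ^+ (\sum_i O i j)))).
    by rewrite ler_wpM2l // !divr_ge0 ?exprn_ge0 // ltW.
  rewrite hs exprD le_eqVlt; apply/orP; left; apply/eqP; field.
  by rewrite expf_neq0 ?gt_eqF.
apply: (@le_trans _ _ ((gam / Cp / z.1 ^+ s) `^ p)); last first.
  have p0 : 0 <= p := le_trans ler01 p1.
  by rewrite ge0_ler_powR ?nnegrE // !divr_ge0 ?exprn_ge0 ?cmod_ge0 // ltW.
rewrite powRM ?invr_ge0 ?exprn_ge0 ?divr_ge0 ?(ltW z0) ?(ltW gam0) ?(ltW Cp0) //.
have -> : (z.1 ^- s) `^ p = ((z.1 ^+ s) `^ p)^-1.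
  by rewrite -powR_inv1 ?exprn_ge0 ?(ltW z0) // -powRrM mulN1r powRN.
rewrite ler_wpM2l ?powR_ge0 //.
rewrite lef_pV2 ?posrE ?powR_gt0 ?exprn_gt0 // -!powR_mulrn ?(ltW z0) // -powRrM.
by apply: ger_powR; rewrite ?z0.
Qed.

End Necessity.

(** * Divisibility by powers of [x], and the equivalence *)

Section Divisibility.
Variables (R : realType) (n : nat) (q : {poly R}).
Hypotheses (n0 : (0 < n)%N) (q0 : q`_0 = 0).

(** The truncation order [D] may depend on the coefficient: that of [x^a y^b] in the substituted
    series is already given by any truncation with [D > a + b]. *)
Lemma real_xpow_divides (c : nat -> nat -> R) r B k : 0 < r -> rconv c r B ->
  (forall a b, (a < k)%N -> exists D, (a + b < D)%N /\ (trunc D c \Po blowup n q)`_b`_a = 0) ->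
  exists G r' B', [/\ 0 < r', rconv G r' B' & forall x y, `|x| <= r' -> `|y| <= r' ->
    rpeval c x (x ^+ n * y - q.[x]) = x ^+ k * rpeval G x y].
Proof.
move=> r0 cB Hc; have [r' [r'0 hB hE]] := compose_conv n r0 cB q0.
have [G [B' [GB GE]]] : exists G B', rconv G r' B' /\ forall x y, `|x| <= r' -> `|y| <= r' ->
    rpeval (recombine c (monom_blowup n q)) x y = x ^+ k * rpeval G x y.
  apply: xfactor_conv r'0 hB _ => a b ak; have [D [abD <-]] := Hc a b ak.
  rewrite coef_trunc_blowup; apply: recombine_wide => // i j.
  exact: low_order_monom_blowup.
by exists G, r', B'; split=> // x y xr yr; rewrite hE // GE.
Qed.

Lemma xpow_dividesI (Q : cpseries R) k : ps_convergent Q ->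
  (forall a b, (a < k)%N -> exists D, (a + b < D)%N /\ (trunc D (ReS Q) \Po blowup n q)`_b`_a = 0) ->
  (forall a b, (a < k)%N -> exists D, (a + b < D)%N /\ (trunc D (ImS Q) \Po blowup n q)`_b`_a = 0) ->
  xpow_divides k n q Q.
Proof.
move=> /ps_convergentP[r [B [r0 cR cI]]] HR HI.
have [G1 [r1 [B1 [r10 GB1 GE1]]]] := real_xpow_divides r0 cR HR.
have [G2 [r2 [B2 [r20 GB2 GE2]]]] := real_xpow_divides r0 cI HI.
pose r' := Num.min r1 r2.
have r'0 : 0 < r' by rewrite lt_min r10.
have r'1 : r' <= r1 by rewrite ge_min lexx.
have r'2 : r' <= r2 by rewrite ge_min lexx orbT.
exists (fun a b => Complex (G1 a b) (G2 a b)); split.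
  apply: (convergent_ps (r := r')) => //.
    exact: rconv_mono (ltW r'0) r'1 GB1.
  exact: rconv_mono (ltW r'0) r'2 GB2.
exists r'; split=> // x y xr yr; rewrite !ps_evalE.
rewrite GE1 ?GE2 ?(le_trans (ltW xr)) ?(le_trans (ltW yr)) //.
by rewrite /ReS /ImS /=; congr Complex; rewrite !mul0r ?subr0 ?addr0.
Qed.

Lemma xpow_dividesE (Q : cpseries R) k D a b : ps_convergent Q -> xpow_divides k n q Q ->
  (a < k)%N -> (a < D)%N ->
  (trunc D (ReS Q) \Po blowup n q)`_b`_a = 0 /\ (trunc D (ImS Q) \Po blowup n q)`_b`_a = 0.
Proof.
move=> /ps_convergentP[r [B [r0 cR cI]]] [G [/ps_convergentP[r' [B' [r'0 gR gI]]] [e [e0 HG]]]] ak aD.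
split.
  apply: (xpow_divides_coef r0 cR n0 q0 r'0 gR e0) ak aD => x y xe ye.
  by have := congr1 (@complex.Re R) (HG x y xe ye); rewrite !ps_evalE /= mul0r subr0.
apply: (xpow_divides_coef r0 cI n0 q0 r'0 gI e0) ak aD => x y xe ye.
by have := congr1 (@complex.Im R) (HG x y xe ye); rewrite !ps_evalE /= mul0r addr0.
Qed.

End Divisibility.

Theorem theorem1p4 (R : realType) (M : nat) (L : 'I_M -> nat)
    (q : 'I_M -> {poly R}) (p : R) (Q : cpseries R) :
  (1 <= M)%N ->
  (forall j, (1 <= L j)%N) ->
  (forall j, (size (q j) <= 2 * L j)%N) ->
  (forall j, (q j).[0] = 0) ->
  1 <= p ->
  ps_convergent Q ->
  (Lp_loc p (fun z => ps_eval Q z.1 z.2 / Pval L q z.1 z.2) <->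
   forall j : 'I_M,
     (((\sum_(i < M) Oij L q i j)%:R - (Num.ceil ((2 * L j + 1)%:R / p))%:~R + 1)%:E
       <= Onq (2 * L j) (q j) Q)%E).
Proof.
move=> M0 L0 _ qh p1 cvQ.
have q0 j : (q j)`_0 = 0 by rewrite -horner_coef0 qh.
have n0 j : (0 < 2 * L j)%N by rewrite muln_gt0 L0.
pose Sj j := (\sum_(i < M) Oij L q i j)%N.
pose z j : int := (Sj j)%:Z - Num.ceil ((2 * L j + 1)%:R / p : R) + 1.
have zE j : (Sj j)%:R - (Num.ceil ((2 * L j + 1)%:R / p))%:~R + 1 = (z j)%:~R :> R.
  by rewrite /z !mulrzDr mulrNz -pmulrn.
have gz j k : good p (2 * L j) (Sj j - k) = (z j <= k%:Z) by rewrite goodE.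
split=> [fQ j|H].
- have exk : exists k, good p (2 * L j) (Sj j - k).
    by exists (Sj j); rewrite subnn /good mul0r ltr0n.
  (* For the least [k] satisfying the inequality, a nonzero coefficient of [x^a] with [a < k] would
     make [a] satisfy it as well, by necessity. *)
  case: (ex_minnP exk) => k gk kmin.
  suff dk : xpow_divides k (2 * L j) (q j) Q.
    rewrite zE; apply: (@le_trans _ _ (k%:R)%:E).
      by rewrite lee_fin [k%:R]pmulrn ler_int -gz.
    by apply: ereal_sup_ubound; exists k.
  have [r [B [r0 cR cI]]] := ps_convergentP cvQ.
  have van c : rconv c r B -> (forall x y, `|rpeval c x y| <= cmod (ps_eval Q x y)) ->
      forall a b, (a < k)%N -> exists D, (a + b < D)%N /\
        (trunc D c \Po blowup (2 * L j) (q j))`_b`_a = 0.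
    move=> cB cQ a b ak; exists ((a + b) + \sum_i 2 * L i).+1; split; first by rewrite ltnS leq_addr.
    rewrite branch_wsubst coef_wsubst coefMXn; case: ltnP => // ba.
    apply/eqP; apply: contraT => nz.
    have := Lp_loc_nec L0 q0 p1 r0 cB cQ fQ _ nz; rewrite ltnS leq_addl => /(_ isT).
    by rewrite subnK // => /kmin; rewrite leqNgt ak.
  apply: xpow_dividesI => //.
    by apply: van => // x y; exact: (Re_le_cmod (ps_eval Q x y)).
  by apply: van => // x y; exact: (Im_le_cmod (ps_eval Q x y)).
(* The supremum [Onq] may be infinite, so a single admissible [k] is extracted: otherwise every
   dividing exponent, being an integer, is at most [z j - 1], and so is the supremum. *)
have dk j : exists k, xpow_divides k (2 * L j) (q j) Q /\ good p (2 * L j) (Sj j - k).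
  apply: contrapT => nok; have := H j; rewrite zE leNgt => /negP; apply.
  apply: (@le_lt_trans _ _ ((z j - 1)%:~R)%:E); last by rewrite lte_fin ltr_int; lia.
  apply: ge_ereal_sup => _ [k dk <-]; rewrite lee_fin [k%:R]pmulrn ler_int.
  have := contra_not (fun g => ex_intro _ k (conj dk g)) nok; rewrite gz => /negP; lia.
have cond : forall j a b, (branch q (trunc (\sum_i 2 * L i).+1 (ReS Q)) j)`_b`_a != 0 \/
    (branch q (trunc (\sum_i 2 * L i).+1 (ImS Q)) j)`_b`_a != 0 ->
    good p (2 * L j) (scale_sum (Oij L q) (2 * L j) j - (a + 2 * L j * b)).
  move=> j a b nz; have [k [dvk gk]] := dk j; rewrite scale_sum_end -/(Sj j).
  have [le_k|lt_k] := leqP k (a + 2 * L j * b).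
    by apply: (good_le p1 _ gk); rewrite leq_sub2l.
  (* Above weight [S] the inequality is trivial; up to [S] the truncation is long enough for
     [xpow_dividesE] to apply. *)
  have [le_S|lt_S] := ltnP (\sum_i 2 * L i) (a + 2 * L j * b).
    have -> : (Sj j - (a + 2 * L j * b) = 0)%N.
      apply/eqP; rewrite subn_eq0 (leq_trans _ (ltnW le_S)) //.
      by rewrite /Sj -scale_sum_end scale_sum_le.
    by rewrite /good mul0r ltr0n.
  have := xpow_dividesE (n0 j) (q0 j) b cvQ dvk lt_k (_ : _ < (\sum_i 2 * L i).+1)%N.
  rewrite ltnS lt_S => /(_ isT).
  rewrite !coef_branch_blowup => -[hR hI].
  by case: nz => /eqP.
apply: Lp_loc_suff => // j a b nz; apply: cond; [by left|by right].
Qed.
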